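(* Let $q$ be an odd prime power that is not prime, and let $C$ be a linear $(n,k+1,q)$-MDS code over $GF(q)$. Let $S$ be the set of codes consisting of $C$ and all (linear or non-linear) extensions of $C$. If $n>q-\sqrt q+k-1$ then: (i) all members of $S$ are LE codes; and (ii) there is, up to equivalence, a unique maximal code in $S$.
   Context: An $(n,k,q)$-MDS code over an alphabet $\mathcal A$ of size $q$ is a set of $q^k$ $n$-tuples (words) over $\mathcal A$ such that no two distinct words agree in $k$ or more coordinate positions. It is linear if $\mathcal A=GF(q)$ and the code is a $k$-dimensional subspace of $GF(q)^n$. An $(m,k,q)$-MDS code $C'$ with $m>n$ (over the same alphabet) is an extension of the $(n,k,q)$-MDS code $C$ if deleting some fixed set of $m-n$ coordinate positions from every word of $C'$ yields $C$. An MDS code is maximal if it admits no extensions. Two codes of length $n$ over $\mathcal A$, viewed as matrices whose rows are the words, are equivalent if one is obtained from the other by a sequence of operations of the types: permuting rows; permuting columns; applying a permutation of the alphabet entrywise to a single column. A code is an LE code if it is equivalent to a linear code.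
   Formalization: Part (ii) is proved for k ≥ 1 only: for k = 0 every (n,1,q)-MDS code can be extended by repeating a column, so no maximal code exists and (ii) fails. *)

(* Defs.v *)
From HB Require Import structures.
From mathcomp Require Import all_boot all_order all_algebra all_fingroup.

Set Implicit Arguments.
Unset Strict Implicit.
Unset Printing Implicit Defensive.

Import GRing.Theory.
Local Open Scope ring_scope.

(* Words of length n over A are row vectors 'rV[A]_n and codes are finite sets
   of words, so permuting the rows of a code matrix has no effect. *)

(* C is an (n, k, #|A|)-MDS code. *)
Definition is_mds (A : finType) (k n : nat) (C : {set 'rV[A]_n}) : Prop :=
  #|C| = (#|A| ^ k)%N /\
  forall u v : 'rV[A]_n, u \in C -> v \in C -> u != v ->
    (#|[set i : 'I_n | u ord0 i == v ord0 i]| < k)%N.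

Definition is_linear (F : finFieldType) (k n : nat) (C : {set 'rV[F]_n})
    : Prop :=
  exists U : {vspace 'rV[F]_n}, \dim U = k /\ C = [set w | w \in U].

(* C' is an extension of C. The strictly increasing map f lists, in order, the
   n positions that are kept; the m - n positions outside its range are the
   deleted ones. *)
Definition is_extension (A : finType) (k n m : nat)
    (C : {set 'rV[A]_n}) (C' : {set 'rV[A]_m}) : Prop :=
  [/\ (n < m)%N, is_mds k C, is_mds k C' &
      exists f : 'I_n -> 'I_m,
        (forall i j : 'I_n, (i < j)%N -> (f i < f j)%N) /\
        C = [set colsub f w | w in C']].

Definition is_maximal (A : finType) (k n : nat) (C : {set 'rV[A]_n}) : Prop :=
  is_mds k C /\
  forall (m : nat) (C' : {set 'rV[A]_m}), ~ is_extension k C C'.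

Definition relabel_col (A : finType) (n : nat) (j : 'I_n) (p : {perm A})
    (w : 'rV[A]_n) : 'rV[A]_n :=
  \row_i (if i == j then p (w ord0 i) else w ord0 i).

Inductive code_equiv (A : finType) (n : nat) (C : {set 'rV[A]_n})
    : {set 'rV[A]_n} -> Prop :=
| Equiv_refl : code_equiv C C
| Equiv_cols (D : {set 'rV[A]_n}) (s : 'S_n) :
    code_equiv C D -> code_equiv C [set col_perm s w | w in D]
| Equiv_symbols (D : {set 'rV[A]_n}) (j : 'I_n) (p : {perm A}) :
    code_equiv C D -> code_equiv C [set relabel_col j p w | w in D].

Definition is_LE (F : finFieldType) (k n : nat) (C : {set 'rV[F]_n}) : Prop :=
  exists L : {set 'rV[F]_n}, is_linear k L /\ code_equiv C L.

(* The family consisting of C and all its extensions; its members have various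
   lengths. *)
Inductive extension_family (A : finType) (k n : nat) (C : {set 'rV[A]_n})
    : forall m : nat, {set 'rV[A]_m} -> Prop :=
| Family_self : extension_family k C C
| Family_ext (m : nat) (C' : {set 'rV[A]_m}) :
    is_extension k C C' -> extension_family k C C'.

(* Main.v *)
Require Import Defs.
From mathcomp Require Import all_boot all_order all_algebra all_fingroup.
From mathcomp Require Import zify ring lra.

Set Implicit Arguments.
Unset Strict Implicit.
Unset Printing Implicit Defensive.

Import Order.TTheory GRing.Theory Num.Theory.
Local Open Scope ring_scope.

(** Write C as the set of all words u *m G, where G has k + 1 rows. That C is
    MDS says that the columns of G form an arc: a nonzero u is orthogonal to at
    most k of them. Put e = q + k - n - 1, or 0 if this is negative; the
    hypothesis on n says that e ^ 2 < q. An odd q that is not prime is at least 9,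
    whence 3 e < q.

    Extensions are equivalent to linear codes. A further column of an extension
    is a function g of u that separates any two u, v whose words in C agree in k
    positions. Two-dimensional slices, obtained by fixing k - 1 coordinates, show
    each level set of g as the graph of a function F -> F whose difference
    quotients avoid n - k values. By a count that goes back to Bruen's bound for
    blocking sets (few_slopes_affine), such a graph is a line once e ^ 2 < q.
    Moreover its slope does not depend on the slice: along any other coordinate
    direction the slope varies affinely, yet it never vanishes, so it is
    constant. Hence all level sets of g are parallel hyperplanes, and g is a
    linear form followed by a permutation of F (extension_linear). Every member
    of the family is therefore a code of the form u *m H with relabelled columns,
    where the columns of H form an arc containing those of G (family_code).

    Unique completion. Let P and Q be two non-proportional vectors, each of which
    extends a large arc; then together they extend it (two_points). Otherwise,
    projecting from k - 2 points of the arc gives an arc in the projective plane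
    and two points P and Q extending it whose joining line meets the arc in a
    point X. With that line at infinity, the remaining points form a set U of
    affine points, no three collinear, on which x, y and x + y are injective.
    Write d = q - #|U|; then d <= e, so that 3 d < q. Segre's lemma of tangents is
    explicit here: after scaling by rho, the squared products of tangent slopes
    at two points A and B agree at the slope of AB. Hence they glue to one
    polynomial in the dual plane, of degree 2 d - 2. Restricted to the pencil of
    X it agrees at q - d > 2 d places with the square of the tangent polynomial
    at X, whose degree is 2 d; this is absurd (no_large_triple_arc).

    Adding points one at a time, a vector extending the arc of G and not
    proportional to a column of a larger arc extends that larger arc as well
    (extends_all). So any two complete arcs containing the columns of G have the
    same columns up to scalars and order, and the corresponding maximal codes are
    equivalent. *)

Lemma leq_card_bigcup (I T : finType) (P : pred I) (A : I -> {set T}) :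
  (#|\bigcup_(i | P i) A i| <= \sum_(i | P i) #|A i|)%N.
Proof.
elim/big_rec2: _ => [|i n B _ le]; first by rewrite cards0.
by rewrite (leq_trans (leq_card_setU _ _)) // leq_add2l.
Qed.

(** This form lets [ring] finish linear consequences of an equation c = d. *)
Lemma eq_from_sub (V : zmodType) (a b c d : V) : c = d -> a - b = c - d -> a = b.
Proof. by move=> -> /eqP; rewrite subrr subr_eq0 => /eqP. Qed.

(** * Functions with few difference quotients *)

Section Slopes.
Variables (F : finFieldType) (f : F -> F) (E : {set F}).
Hypothesis slopes : forall x y, x != y -> (f x - f y) / (x - y) \notin E.

(** A line of slope a through a point off the graph of f, at abscissa b: every
    slope in E is attained once from that point, so few points of the graph
    remain for the line itself. *)
Lemma line_meets_graph (a b c : F) : a \notin E -> f b != c + a * b ->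
  (#|[set x | f x == (c + a * x)%R]| < #|~: E|)%N.
Proof.
move=> aE nfb; set L := [set x | _].
pose sig x := (f x - (c + a * b)) / (x - b).
have bL : b \notin L by rewrite inE.
have sigL x : x \in L -> sig x = a.
  rewrite inE => /eqP fx; have d0 : x - b != 0.
    by rewrite subr_eq0; apply: contraNneq bL => <-; rewrite inE fx.
  by apply: (mulIf d0); rewrite /sig divfK // fx; ring.
(* x |-> f x - e x is bijective for e in E, so slope e occurs from that point. *)
have sub : E \subset sig @: ~: (b |: L).
  apply/subsetP => e eE.
  have inj : injective (fun x => f x - e * x).
    move=> x y /= fxy; apply/eqP; apply: contraT => nxy.
    have d0 : x - y != 0 by rewrite subr_eq0.
    have := slopes nxy; have -> : (f x - f y) / (x - y) = e; last by rewrite eE.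
    by apply: (mulIf d0); rewrite divfK //; apply: (eq_from_sub fxy); ring.
  have [x hx] : exists x, f x - e * x = (c + a * b) - e * b.
    by exists (invF inj ((c + a * b) - e * b)); apply: (f_invF inj).
  have xb : x != b.
    by apply: contraNneq nfb => xb; move: hx; rewrite xb => /addIr->.
  have d0 : x - b != 0 by rewrite subr_eq0.
  have sx : sig x = e by apply: (mulIf d0); rewrite /sig divfK //; apply: (eq_from_sub hx); ring.
  apply/imsetP; exists x => //; rewrite !inE negb_or xb /=.
  apply: contra aE => fx; have <- : sig x = a by apply: sigL; rewrite inE.
  by rewrite sx.
have := leq_trans (subset_leq_card sub) (leq_imset_card _ _).
have := cardsC E; have := cardsC (b |: L); rewrite cardsU1 bL; lia.
Qed.

(** Bruen's bound: the graph of a function that is not affine determines at least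
    1 + sqrt q slopes. *)
Lemma few_slopes_affine :
  ((#|~: E|).-1 ^ 2 < #|F|)%N -> exists a, forall x, f x = f 0 + a * x.
Proof.
move=> small.
case: (boolP [exists a, [forall x, f x == f 0 + a * x]]) => [/existsP[a /forallP h]|].
  by exists a => x; apply/eqP.
rewrite negb_exists => /forallP nex; exfalso.
pose L a := [set x | f x == f 0 + a * x].
(* Sort the points other than 0 by the slope of their chord to (0, f 0). *)
have cover : [set~ 0] \subset \bigcup_(a in ~: E) (L a :\ 0).
  apply/subsetP => x; rewrite !inE => x0.
  have := slopes x0; rewrite subr0 => aE.
  apply/bigcupP; exists ((f x - f 0) / x); rewrite !inE ?x0 //=.
  by rewrite divfK // addrC subrK.
have := subset_leq_card cover; rewrite cardsC1 => /leq_trans.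
have le : (#|\bigcup_(a in ~: E) (L a :\ 0%R)| <= \sum_(a in ~: E) #|~: E|.-2)%N.
  apply: (leq_trans (leq_card_bigcup _ _)).
  apply: leq_sum => a; rewrite inE => aE.
  have := nex a; rewrite negb_forall => /existsP[b nfb].
  have := line_meets_graph aE nfb; rewrite -/(L a).
  have := cardsD1 (0 : F) (L a); rewrite inE mulr0 addr0 eqxx => ->.
  by case: #|~: E| => [|[|N]].
move=> /(_ _ le); rewrite sum_nat_const => le2.
have {}le2 : (#|F|.-1 <= #|~: E| * #|~: E|.-2)%N by exact: le2.
move: le2.
have := card_finNzRing_gt1 F.
by case: #|~: E| small => [|[|N]] /=; rewrite -?mulnn; move: #|F| => q; nia.
Qed.
End Slopes.

(** * Segre's tangents for a plane arc with three points at infinity *)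

Lemma eq_poly_on (F : finFieldType) (T : {set F}) (p r : {poly F}) :
  (size p <= #|T|)%N -> (size r <= #|T|)%N -> {in T, forall x, p.[x] = r.[x]} -> p = r.
Proof.
move=> sp sr eq_pr; apply/eqP; rewrite -subr_eq0; apply: contraT => nz.
have : all (root (p - r)) (enum T).
  apply/allP => x; rewrite mem_enum => xT.
  by rewrite rootE hornerD hornerN eq_pr // subrr.
move/(max_poly_roots nz)/(_ (enum_uniq _)); rewrite -cardE ltnNge.
by rewrite (leq_trans (size_polyD _ _)) // size_polyN geq_max sp.
Qed.

Lemma subset_of_card (T : finType) (A : {set T}) n : (n <= #|A|)%N ->
  exists2 B : {set T}, B \subset A & #|B| = n.
Proof.
case/card_geqP => s [us <- sA]; exists [set x in s].
  by apply/subsetP => x; rewrite inE => /sA.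
by rewrite cardsE; apply/card_uniqP.
Qed.

Lemma size_prod_linear (F : fieldType) (I : finType) (P : pred I) (p : I -> {poly F}) :
  (forall i, (size (p i) <= 2)%N) -> (size (\prod_(i | P i) p i)%R <= #|P|.+1)%N.
Proof.
move=> sp; apply: leq_trans (size_prod_leq _ _) _.
have : (\sum_(i | P i) size (p i) <= \sum_(i | P i) 2)%N by apply: leq_sum.
by rewrite sum_nat_const [#|P|]/=; lia.
Qed.

(** Horner rules for the polynomials of degree one in the gluing argument. *)
Definition hornerS := (hornerD, hornerN, hornerM, hornerC, hornerX).

Section Plane.
Variable F : finFieldType.
Implicit Types (T : {set F}) (A B C : F * F) (U E : {set F * F}).

(** The monic polynomial whose roots are the elements outside T. *)
Definition missing T : {poly F} := \prod_(m in ~: T) ('X - m%:P).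

Lemma size_missing T : size (missing T) = #|~: T|.+1.
Proof. by rewrite /missing -big_enum size_prod_XsubC -cardE. Qed.

(** The factors t - m over all m other than t multiply to the product of all
    nonzero elements; those with m in T complement the value of [missing]. *)
Lemma horner_missing t T : t \notin T ->
  (missing (t |: T)).[t] * \prod_(m in T) (t - m) = \prod_(m : F | m != 0) m.
Proof.
move=> tT; rewrite /missing horner_prod.
under eq_bigr do rewrite hornerXsubC.
rewrite [RHS](reindex_inj (h := fun m : F => t - m)) /=; last first.
  by move=> a b /addrI/oppr_inj.
rewrite [RHS](bigID (mem T)) /= mulrC; congr (_ * _); apply: eq_bigl => m.
  by rewrite subr_eq0; case: eqP tT => [<- /negbTE-> | ] //=; rewrite andbF.
by rewrite !inE negb_or subr_eq0 eq_sym.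
Qed.


Lemma prod_nonzero_neq0 : \prod_(m : F | m != 0) m != 0.
Proof. exact/prodf_neq0. Qed.

(** The slope of the line AB. *)
Definition slope A B : F := (B.2 - A.2) / (B.1 - A.1).

Lemma slopeC A B : slope A B = slope B A.
Proof. by rewrite /slope -[B.2 - _]opprB -[B.1 - _]opprB invrN mulrNN. Qed.

(** It vanishes exactly when A, B and C are collinear. *)
Definition det3 A B C : F :=
  (B.1 - A.1) * (C.2 - A.2) - (C.1 - A.1) * (B.2 - A.2).

(** U stands for the affine points of an arc that also has points at infinity in
    the directions 0, infinity and -1. *)
Variable U : {set F * F}.
Hypothesis inj1 : {in U &, injective (fun A => A.1)}.
Hypothesis inj2 : {in U &, injective (fun A => A.2)}.
Hypothesis injD : {in U &, injective (fun A => A.1 + A.2)}.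
Hypothesis noncollinear : {in U & &, forall A B C,
  A != B -> A != C -> B != C -> det3 A B C != 0}.

Lemma sub1_neq0 A B : A \in U -> B \in U -> A != B -> B.1 - A.1 != 0.
Proof. by move=> AU BU; apply: contra; rewrite subr_eq0 => /eqP/esym/inj1->. Qed.

Lemma slopeE A B : A \in U -> B \in U -> A != B ->
  slope A B * (B.1 - A.1) = B.2 - A.2.
Proof. by move=> AU BU nAB; rewrite divfK // sub1_neq0. Qed.

Lemma slope_inj A : A \in U -> {in U :\ A &, injective (slope A)}.
Proof.
move=> AU B C; rewrite !inE => /andP[nBA BU] /andP[nCA CU] eqs.
apply/eqP; apply: contraT => nBC.
have := noncollinear AU BU CU; rewrite eq_sym nBA eq_sym nCA => /(_ isT isT nBC).
rewrite /det3 -!(@slopeE A) // 1?eq_sym // eqs => /negP[].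
by apply/eqP; ring.
Qed.

Lemma slope_neq0 A B : A \in U -> B \in U -> A != B -> slope A B != 0.
Proof.
move=> AU BU nAB; apply: contra (nAB) => /eqP s0; apply/eqP/inj2 => //.
by have := slopeE AU BU nAB; rewrite s0 mul0r; move/eqP; rewrite eq_sym subr_eq0 => /eqP.
Qed.

Lemma slope_neqN1 A B : A \in U -> B \in U -> A != B -> slope A B != -1.
Proof.
move=> AU BU nAB; apply: contra (nAB) => /eqP s0; apply/eqP/injD => //.
by have := slopeE AU BU nAB; rewrite s0 => h; apply: (eq_from_sub h); ring.
Qed.


(** The slopes, other than infinity, of the lines through A that meet U again or
    meet infinity in direction 0 or -1. *)
Definition secants A : {set F} := 0 |: (-1 |: slope A @: (U :\ A)).

(** The tangent polynomial at A: its roots are the slopes of the tangents at A.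
    The factor makes Segre's relation hold with constant 1 up to sign. *)
Definition rho A : {poly F} :=
  (\prod_(C in U :\ A) (C.1 - A.1))^-1 *: missing (secants A).

Lemma slope_in A B : B \in U :\ A -> (A != B) * (B \in U).
Proof. by rewrite !inE eq_sym => /andP[-> ->]. Qed.

Lemma secants_notin A (T : {set F * F}) : A \in U -> T \subset U :\ A ->
  (0 \notin -1 |: slope A @: T) * (-1 \notin slope A @: T).
Proof.
move=> AU /subsetP TU; have N1 : -1 \notin slope A @: T.
  apply/imsetP => -[B /TU/slope_in BU /eqP].
  by rewrite eq_sym; apply/negP/slope_neqN1; rewrite ?BU.
split=> //; rewrite !inE negb_or eq_sym oppr_eq0 oner_eq0 /=.
apply/imsetP => -[B /TU/slope_in BU /eqP].
by rewrite eq_sym; apply/negP/slope_neq0; rewrite ?BU.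
Qed.

Lemma wprod_neq0 A : A \in U -> \prod_(C in U :\ A) (C.1 - A.1) != 0.
Proof. by move=> AU; apply/prodf_neq0 => C /slope_in CU; rewrite sub1_neq0 ?CU. Qed.

Lemma size_rho A : A \in U -> (size (rho A) + #|U| = #|F|)%N.
Proof.
move=> AU; rewrite size_scale ?invr_eq0 ?wprod_neq0 // size_missing.
have [n0 n1] := secants_notin AU (subxx _).
have := cardsC (secants A); rewrite cardsU1 n0 cardsU1 n1 card_in_imset; last first.
  exact: slope_inj.
by rewrite (cardsD1 A U) AU /= => <-; rewrite addSn addnC.
Qed.

(* The factors that complete the tangent slopes at A to all elements other than
   slope A B, with denominators cleared; the result is symmetric in A and B. *)
Let kern A B : F := slope A B * ((slope A B + 1) *
   \prod_(C in U :\ A :\ B) ((slope A B - slope A C) * (C.1 - A.1))).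

Lemma kernC A B : A \in U -> B \in U -> A != B -> kern A B = kern B A.
Proof.
move=> AU BU nAB; rewrite /kern (slopeC B A) !setDDl setUC.
congr (_ * (_ * _)); apply: eq_bigr => C; rewrite !inE negb_or.
case/andP=> /andP[nCB nCA] CU; rewrite !mulrBl (slopeE AU CU) 1?eq_sym //.
rewrite (slopeE BU CU) 1?eq_sym //; apply: (eq_from_sub (slopeE AU BU nAB)); ring.
Qed.

Lemma rho_slope A B : A \in U -> B \in U -> A != B ->
  (rho A).[slope A B] * (kern A B * (B.1 - A.1)) = \prod_(m : F | m != 0) m.
Proof.
move=> AU BU nAB; have BUA : B \in U :\ A by rewrite !inE eq_sym nAB.
set W := U :\ A :\ B.
have WU : W \subset U :\ A by apply: subsetDl.
have [n0 n1] := secants_notin AU WU.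
have sE : secants A = slope A B |: (0 |: (-1 |: slope A @: W)).
  by rewrite /secants -(setD1K BUA) imsetU1 -/W (setUCA [set -1]) (setUCA [set 0]).
have tT : slope A B \notin 0 |: (-1 |: slope A @: W).
  rewrite !inE !negb_or slope_neq0 // slope_neqN1 //=.
  apply/imsetP => -[C CW]; move: (CW); rewrite in_setD1 => /andP[nCB CUA] /slope_inj eqBC.
  by case/eqP: nCB; rewrite eqBC.
rewrite -(horner_missing tT) -sE big_setU1 // big_setU1 //= big_imset /=; last first.
  by move=> C D CW DW; apply: slope_inj => //; apply: (subsetP WU).
rewrite /rho hornerZ /kern big_split /= (big_setD1 _ BUA) /= -/W subr0 opprK.
set w := \prod_(_ in W) _; set r := (missing _).[_].
have w0 : w != 0.
  apply/prodf_neq0 => C CW; have CU := slope_in (subsetP WU _ CW).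
  by rewrite sub1_neq0 ?CU.
set v := \prod_(_ in W) _; have d0 := sub1_neq0 AU BU nAB.
by field; rewrite w0 d0.
Qed.

(** Segre's lemma of tangents; squaring removes the sign. *)
Lemma rho_sqr_slope A B : A \in U -> B \in U -> A != B ->
  (rho A ^+ 2).[slope A B] = (rho B ^+ 2).[slope B A].
Proof.
move=> AU BU nAB; have nBA : B != A by rewrite eq_sym.
have hA := rho_slope AU BU nAB; have hB := rho_slope BU AU nBA.
have O0 := prod_nonzero_neq0; rewrite -hA in O0.
have k0 : kern A B * (B.1 - A.1) != 0.
  by apply: contraNneq O0 => ->; rewrite mulr0.
apply: (mulIf (expf_neq0 2 k0)); rewrite !horner_exp -exprMn hA -hB -kernC //.
by ring.
Qed.

(** The parameter of the line through A in direction -1. *)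
Definition csum A : F := A.1 + A.2.

(** Segre's lemma for a point B of U and the point at infinity in direction -1,
    whose tangent polynomial is [missing (csum @: U)]. *)
Lemma rho_sqr_N1 B : B \in U ->
  (rho B ^+ 2).[-1] = (missing (csum @: U) ^+ 2).[csum B].
Proof.
move=> BU; set p := \prod_(C in U :\ B) (csum B - csum C).
have p0 : p != 0.
  apply/prodf_neq0 => C /slope_in CU; rewrite subr_eq0.
  by apply: contra (CU.1) => /eqP/injD->; rewrite ?CU.
have hr : (missing (csum @: U)).[csum B] * p = \prod_(m : F | m != 0) m.
  have UE : csum @: U = csum B |: csum @: (U :\ B) by rewrite -imsetU1 setD1K.
  rewrite UE -(@horner_missing (csum B) (csum @: (U :\ B))); last first.
    apply/imsetP => -[C CU eqc]; have eqBC : B = C by apply: injD; rewrite ?(slope_in CU).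
    by move: CU; rewrite -eqBC !inE eqxx.
  rewrite big_imset //= => C D /slope_in[_ CU] /slope_in[_ DU]; exact: injD.
have hb : (rho B).[-1] * p = - \prod_(m : F | m != 0) m.
  have [n0 n1] := secants_notin BU (subxx _).
  have tT : -1 \notin 0 |: slope B @: (U :\ B).
    by rewrite !inE negb_or n1 oppr_eq0 oner_eq0.
  rewrite -(horner_missing tT) setUCA -/(secants B) big_setU1 /=; last first.
    by apply: contra n0; rewrite !inE => ->; rewrite orbT.
  rewrite big_imset /=; last exact: slope_inj.
  have -> : p = \prod_(C in U :\ B) (-1 - slope B C) * \prod_(C in U :\ B) (C.1 - B.1).
    rewrite -big_split /=; apply: eq_bigr => C /slope_in CU.
    by rewrite mulrBl slopeE ?CU // /csum; ring.
  by rewrite /rho hornerZ subr0; field; rewrite wprod_neq0.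
apply: (mulIf (expf_neq0 2 p0)); rewrite !horner_exp -!exprMn hb hr sqrrN //.
Qed.


Variable E : {set F * F}.
Hypothesis EU : E \subset U.

(* Lines y = m x + c are points (m, c) of the dual plane, and [lin C] is the
   equation of the dual line of C, evaluated at polynomials m and c. *)
Let lin C (m c : {poly F}) : {poly F} := C.2%:P - C.1%:P * m - c.

Let coef A B : F := (rho A ^+ 2).[slope A B] /
  \prod_(C in E :\ A :\ B) (C.2 - C.1 * slope A B - (A.2 - A.1 * slope A B)).

(** Lagrange interpolation in the dual plane at the joining lines AB of the points
    of E, with values [rho A ^+ 2] at [slope A B]. The order on the finite type
    selects one ordered pair from each unordered pair. Taking m and c to be
    polynomials gives the restrictions to lines of the dual plane. *)
Definition glue (m c : {poly F}) : {poly F} :=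
  \sum_(P : (F * F) * (F * F) |
      [&& P.1 \in E, P.2 \in E & (enum_rank P.1 < enum_rank P.2)%N])
    (coef P.1 P.2)%:P * \prod_(C in E :\ P.1 :\ P.2) lin C m c.

Lemma size_glue m c :
  (forall C, (size (C.2%:P - C.1%:P * m - c)%R <= 2)%N) -> (size (glue m c) <= #|E|.-1)%N.
Proof.
move=> sl; apply: (leq_trans (size_sum _ _ _)).
apply/bigmax_leqP => -[A B] /= /and3P[AE BE ltAB].
have BEA : B \in E :\ A by rewrite !inE BE andbT; apply: contraTneq ltAB => ->; rewrite ltnn.
rewrite mul_polyC (leq_trans (size_scale_leq _ _)) //.
apply: leq_trans (size_prod_linear _ _) _ => //.
by rewrite (cardsD1 A E) AE (cardsD1 B (E :\ A)) BEA.
Qed.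

Lemma glue_vertex m c t A B : A \in E -> B \in E -> A != B ->
  m.[t] = slope A B -> c.[t] = A.2 - A.1 * slope A B ->
  (glue m c).[t] = (rho A ^+ 2).[slope A B].
Proof.
wlog ltAB : A B / (enum_rank A < enum_rank B)%N.
  move=> wl AE BE nAB mt ct; case: (ltngtP (enum_rank A) (enum_rank B)) => [lt|gt|eq].
  - exact: wl.
  - rewrite rho_sqr_slope ?(subsetP EU) //; apply: wl; rewrite // 1?eq_sym // (slopeC B A) //.
    rewrite ct.
    apply: (eq_from_sub (slopeE (subsetP EU _ AE) (subsetP EU _ BE) nAB)); ring.
  - by case/eqP: nAB; apply/enum_rank_inj/val_inj.
move=> AE BE nAB mt ct; rewrite /glue horner_sum.
rewrite (bigD1 (A, B)) /=; last by rewrite AE BE.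
have lt C : (lin C m c).[t] = C.2 - C.1 * slope A B - (A.2 - A.1 * slope A B).
  by rewrite /lin !hornerS mt ct.
rewrite [X in _ + X]big1 ?addr0 => [|[A' B'] /= /andP[/and3P[AE' BE' ltAB'] nP]]; last first.
  (* One of A, B is not among A', B', and its factor vanishes. *)
  have [C [CE C0]] : exists C, C \in E :\ A' :\ B' /\ (lin C m c).[t] = 0.
    case: (boolP (A \in [:: A'; B'])) => [Ain|]; last first.
      rewrite !inE negb_or => /andP[nAA nAB'].
      by exists A; rewrite !inE nAA nAB' AE lt; split=> //; ring.
    exists B; split.
      rewrite !inE BE andbT; apply/andP; split; apply/eqP => eB.
        move: Ain; rewrite !inE -eB (negbTE nAB) orbF => /eqP eA.
        by case/eqP: nP; rewrite eA eB.
      move: Ain; rewrite !inE -eB (negbTE nAB) /= => /eqP eA.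
      by move: ltAB'; rewrite -eA -eB ltnNge ltnW.
    rewrite lt; apply: (eq_from_sub (esym (slopeE (subsetP EU _ AE) (subsetP EU _ BE) nAB))); ring.
  by rewrite hornerM horner_prod (big_setD1 C) //= C0 mul0r mulr0.
rewrite hornerM hornerC horner_prod; under eq_bigr do rewrite lt.
rewrite /coef divfK //; apply/prodf_neq0 => C; rewrite !inE => /and3P[nCB nCA CE].
have [AU BU CU] := And3 (subsetP EU _ AE) (subsetP EU _ BE) (subsetP EU _ CE).
have -> : C.2 - C.1 * slope A B - (A.2 - A.1 * slope A B) =
   (slope A C - slope A B) * (C.1 - A.1).
  by rewrite mulrBl slopeE // 1?eq_sym //; ring.
apply: mulf_neq0; last by rewrite sub1_neq0 // eq_sym.
rewrite subr_eq0.
by apply: contra (nCB) => /eqP/slope_inj->; rewrite ?inE // ?nCA // eq_sym nAB.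
Qed.

(** On the dual line of any point B of U, on E or not, the glued polynomial is the
    squared tangent polynomial at B. *)
Lemma glue_line (k : nat) : #|E| = k.+2 ->
  {in U, forall B, (size (rho B ^+ 2)%R <= k.+1)%N} ->
  {in U, forall B, glue 'X (B.2%:P - B.1%:P * 'X) = rho B ^+ 2}.
Proof.
move=> cE sr.
have sl B : (size (glue 'X (B.2%:P - B.1%:P * 'X)) <= k.+1)%N.
  have -> : k.+1 = #|E|.-1 by rewrite cE.
  apply: size_glue => C; have -> : C.2%:P - C.1%:P * 'X - (B.2%:P - B.1%:P * 'X) =
     (C.2 - B.2)%:P - (C.1 - B.1)%:P * 'X :> {poly F} by rewrite !polyCB; ring.
  rewrite (leq_trans (size_polyD _ _)) // geq_max size_polyN.
  rewrite (leq_trans (size_polyC_leq1 _)) //=.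
  by rewrite mul_polyC (leq_trans (size_scale_leq _ _)) // size_polyX.
have from_vertices B : B \in U ->
    {in E :\ B, forall A, (glue 'X (B.2%:P - B.1%:P * 'X)).[slope B A] =
                           (rho B ^+ 2).[slope B A]} ->
    glue 'X (B.2%:P - B.1%:P * 'X) = rho B ^+ 2.
  move=> BU eqv.
  have ck : (k < #|slope B @: (E :\ B)|)%N.
    rewrite card_in_imset; last first.
      by apply: sub_in2 (slope_inj BU) => C; apply/subsetP/setSD.
    by have := cardsD1 B E; rewrite cE; move: #|_| => z; case: (B \in E) => /=; lia.
  apply: (@eq_poly_on _ (slope B @: (E :\ B))).
  - exact: leq_trans (sl B) ck.
  - exact: leq_trans (sr _ BU) ck.
  by move=> _ /imsetP[A AE ->]; apply: eqv.
have lineE A : A \in E -> glue 'X (A.2%:P - A.1%:P * 'X) = rho A ^+ 2.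
  move=> AE; apply: from_vertices => [|B]; first exact: (subsetP EU).
  rewrite !inE => /andP[nBA BE].
  by apply: glue_vertex; rewrite // 1?eq_sym // !hornerS.
move=> B BU; case: (boolP (B \in E)) => [/lineE //|nBE].
apply: from_vertices => // A; rewrite !inE => /andP[nAB AE].
have AU := subsetP EU _ AE; have nBA : B != A by rewrite eq_sym.
rewrite (rho_sqr_slope BU AU nBA) -(lineE A AE) (slopeC A B).
rewrite /glue !horner_sum; apply: eq_bigr => P _; rewrite !hornerM !horner_prod.
congr (_ * _); apply: eq_bigr => C _; rewrite !hornerS.
apply: (eq_from_sub (esym (slopeE BU AU nBA))); ring.
Qed.
End Plane.

(** An arc of the plane with points at infinity in directions 0, infinity and -1
    has few affine points; note that these three points are collinear. *)
Theorem no_large_triple_arc (F : finFieldType) (U : {set F * F}) :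
  {in U &, injective (fun A => A.1)} -> {in U &, injective (fun A => A.2)} ->
  {in U &, injective (fun A => A.1 + A.2)} ->
  {in U & &, forall A B C, A != B -> A != C -> B != C -> det3 A B C != 0} ->
  (2 * #|F| < 3 * #|U|)%N -> False.
Proof.
move=> inj1 inj2 injD ncol big.
have srho := size_rho inj1 inj2 injD ncol.
have [B0 B0U] : exists B, B \in U.
  by apply/set0Pn/eqP => U0; move: big; rewrite U0 cards0 muln0.
have [k ek] : exists k, (size (rho U B0)).-1.*2 = k by eexists.
have rho_gt0 : (0 < size (rho U B0))%N.
  rewrite lt0n size_poly_eq0 scaler_eq0 invr_eq0 (negbTE (wprod_neq0 inj1 B0U)) /=.
  by rewrite -size_poly_eq0 size_missing.
have e := srho _ B0U.
have kU : (k.+2 < #|U|)%N by lia.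
have [E EU cE] : exists2 E : {set F * F}, E \subset U & #|E| = k.+2.
  by apply: subset_of_card; apply: ltnW.
have sr2 : {in U, forall B, (size (rho U B ^+ 2)%R <= k.+1)%N}.
  move=> B BU; have eB := srho _ BU.
  by apply: leq_trans (size_poly_exp_leq _ _) _; rewrite -ek muln2; lia.
have gl := glue_line inj1 inj2 injD ncol EU cE sr2.
pose r := missing (@csum F @: U).
have sr2r : size (r ^+ 2) = (k.+2).+1.
  have cm : #|~: (@csum F @: U)| = size (rho U B0).
    apply/(@addIn #|U|); rewrite e -(cardsC (@csum F @: U)) card_in_imset //.
    exact: addnC.
  have : (size (r ^+ 2)).-1 = k.+2.
    by rewrite size_exp /r size_missing -ek cm muln2; case: (size _) rho_gt0.
  by case: (size _) => [|s] //= ->.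
have sg : (size (glue U E (-1) 'X) <= k.+1)%N.
  have -> : k.+1 = #|E|.-1 by rewrite cE.
  apply: size_glue => C; have -> : C.2%:P - C.1%:P * -1 - 'X = (C.2 + C.1)%:P - 'X :> {poly F}.
    by rewrite polyCD; ring.
  by rewrite -opprB size_polyN size_XsubC.
(* The dual line m = -1 is the pencil of the point at infinity of slope -1. *)
have gr : glue U E (-1) 'X = r ^+ 2.
  have cU : (k.+2 < #|@csum F @: U|)%N by rewrite card_in_imset.
  apply: (@eq_poly_on _ (@csum F @: U)); rewrite ?sr2r //.
    by rewrite (leq_trans sg) // ltnW // ltnW.
  move=> _ /imsetP[B BU ->]; rewrite -rho_sqr_N1 // -gl //.
  rewrite /glue !horner_sum; apply: eq_bigr => P _; rewrite !hornerM !hornerC !horner_prod.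
  congr (_ * _); apply: eq_bigr => C _; rewrite -polyC1 -polyCN !hornerS /csum; ring.
by move: sg; rewrite gr sr2r; lia.
Qed.

(** * Arcs of column vectors *)

(** The columns of H orthogonal to u. *)
Definition zero_cols (F : finFieldType) (k m : nat) (H : 'M[F]_(k, m))
    (u : 'rV_k) : {set 'I_m} :=
  [set j | (u *m H) 0 j == 0].

(** The columns of H form an arc: a nonzero u is orthogonal to at most k of them.
    When there are at least k + 1 columns, this says that any k + 1 of them are
    linearly independent. *)
Definition is_arc (F : finFieldType) (k m : nat) (H : 'M[F]_(k.+1, m)) : bool :=
  [forall u, (u != 0) ==> (#|zero_cols H u| <= k)%N].

Lemma is_arcP (F : finFieldType) (k m : nat) (H : 'M[F]_(k.+1, m)) :
  reflect (forall u, u != 0 -> (#|zero_cols H u| <= k)%N) (is_arc H).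
Proof.
by apply: (iffP forallP) => h u; [apply/implyP/(h u) | apply/implyP/h].
Qed.

Lemma entryD (F : fieldType) (k m : nat) (H : 'M[F]_(k, m)) (u v : 'rV_k) i :
  ((u + v) *m H) 0 i = (u *m H) 0 i + (v *m H) 0 i.
Proof. by rewrite mulmxDl mxE. Qed.

Lemma entryZ (F : fieldType) (k m : nat) (H : 'M[F]_(k, m)) a (u : 'rV_k) i :
  ((a *: u) *m H) 0 i = a * (u *m H) 0 i.
Proof. by rewrite -scalemxAl mxE. Qed.

Lemma entry_sum (F : fieldType) (k m : nat) (H : 'M[F]_(k, m)) (I : finType) (P : pred I)
    (u : I -> 'rV_k) i :
  ((\sum_(x | P x) u x) *m H) 0 i = \sum_(x | P x) (u x *m H) 0 i.
Proof. by rewrite mulmx_suml summxE. Qed.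

(** At most k vectors of dimension k + 1 have a common nonzero orthogonal vector. *)
Lemma common_zero (F : finFieldType) (k m : nat) (H : 'M[F]_(k.+1, m)) (B : {set 'I_m}) :
  (#|B| <= k)%N -> exists2 u, u != 0 & B \subset zero_cols H u.
Proof.
move=> Bk; pose A := colsub (fun i : 'I_#|B| => enum_val i) H.
have : kermx A != 0.
  by rewrite kermx_eq0 -row_leq_rank -ltnNge (leq_ltn_trans (rank_leq_col _)).
case/rowV0Pn => u /sub_kermxP uA u0; exists u => //.
apply/subsetP => j jB; rewrite inE.
have : (u *m A) 0 (enum_rank_in jB j) = 0 by rewrite uA mxE.
by rewrite mulmx_colsub mxE enum_rankK_in // => ->.
Qed.

(** * Every further column of an extension is linear up to relabelling *)

Section LinearExtension.
Variables (F : finFieldType) (k n : nat) (G : 'M[F]_(k.+1, n)).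
Hypotheses (arcG : is_arc G) (kn : (k.+1 <= n)%N).
Hypothesis n_large : ((#|F| + k - n.+1) ^ 2 < #|F|)%N.
Variable g : 'rV[F]_k.+1 -> F.
Hypothesis sep : forall u v, u != v -> (k <= #|zero_cols G (u - v)|)%N -> g u != g v.

(* The first k + 1 positions form an information set. *)
Let wid : 'I_k.+1 -> 'I_n := widen_ord kn.
Let wid_inj : injective wid. Proof. by move=> i j /(congr1 val)/= /val_inj. Qed.
Let G1 := colsub wid G.

Lemma G1_unit : G1 \in unitmx.
Proof.
rewrite -row_free_unit; apply: inj_row_free => u uG; apply/eqP; apply: contraT => u0.
have := is_arcP _ arcG u u0; rewrite leqNgt => /negP[].
rewrite -[X in (X <= _)%N]card_ord -cardsT -(card_imset _ wid_inj) subset_leq_card //.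
apply/subsetP => _ /imsetP[l _ ->]; rewrite inE.
by have := congr1 (fun v : 'rV_k.+1 => v 0 l) uG; rewrite mulmx_colsub !mxE => ->.
Qed.

(* The message basis that is systematic on those positions. *)
Let e (j : 'I_k.+1) : 'rV[F]_k.+1 := row j (invmx G1).

Let eE j l : (e j *m G) 0 (wid l) = (j == l)%:R.
Proof.
have : (e j *m G1) 0 l = (j == l)%:R.
  by rewrite -row_mul mulVmx ?G1_unit // !mxE.
by rewrite mulmx_colsub mxE.
Qed.

Let coords u : u = \sum_j (u *m G1) 0 j *: e j.
Proof. by rewrite -mulmx_sum_row mulmxK // G1_unit. Qed.

(* All the systematic positions except the first. *)
Let W : {set 'I_n} := wid @: [set~ 0].

Let e_neq0 j : e j != 0.
Proof.
apply/eqP => ej0; have := eE j j; rewrite ej0 mul0mx mxE eqxx => /eqP.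
by rewrite eq_sym oner_eq0.
Qed.

Let zeros_e0 : zero_cols G (e 0) = W.
Proof.
apply/esym/eqP; rewrite eqEcard; apply/andP; split.
  apply/subsetP => _ /imsetP[l + ->]; rewrite !inE eE eq_sym => /negbTE->; exact: eqxx.
by rewrite card_imset // cardsC1 card_ord; apply: (is_arcP _ arcG).
Qed.

Let cardW : #|W| = k.
Proof. by rewrite card_imset // cardsC1 card_ord. Qed.

Let inj0 u : injective (fun y => g (u + y *: e 0)).
Proof.
move=> y z /eqP eqg; apply/eqP; apply: contraLR eqg => nyz.
have yz0 : y - z != 0 by rewrite subr_eq0.
have E : u + y *: e 0 - (u + z *: e 0) = (y - z) *: e 0.
  by rewrite opprD addrACA subrr add0r scalerBl.
apply: sep; first by rewrite -subr_eq0 E scaler_eq0 negb_or yz0 e_neq0.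
rewrite E -[X in (X <= _)%N]cardW -zeros_e0 subset_leq_card //; apply/subsetP => i.
by rewrite !inE entryZ => /eqP->; rewrite mulr0.
Qed.

Let wid0 j : j != 0 -> wid j \in W.
Proof. by move=> j0; rewrite imset_f // !inE. Qed.

Let cardWj j : j != 0 -> (#|W :\ wid j|.+1 = k)%N.
Proof. by move=> j0; have := cardsD1 (wid j) W; rewrite wid0 // cardW => ->. Qed.

Let zeros_dir j s : W :\ wid j \subset zero_cols G (e j + s *: e 0).
Proof.
apply/subsetP => i; rewrite in_setD1 => /andP[nij /imsetP[l l0 ei]].
move: nij l0; rewrite ei !inE (inj_eq wid_inj) => nlj nl0.
by rewrite entryD entryZ !eE (eq_sym j) (negbTE nlj) (eq_sym _ l) (negbTE nl0) mulr0 addr0.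
Qed.

Let dir_neq0 j s : j != 0 -> e j + s *: e 0 != 0.
Proof.
move=> j0; apply/eqP => d0; have : ((e j + s *: e 0) *m G) 0 (wid j) = 0.
  by rewrite d0 mul0mx mxE.
rewrite entryD entryZ !eE eqxx (eq_sym _ j) (negbTE j0) mulr0 addr0 => /eqP.
by rewrite oner_eq0.
Qed.

Let notW i : (i \notin W) = ((e 0 *m G) 0 i != 0).
Proof. by rewrite -zeros_e0 inE. Qed.

(* The slope s for which the direction e j + s e 0 vanishes at position i; since
   it also vanishes on W minus one position, g is injective along it. *)
Let ratio j i := - (e j *m G) 0 i / (e 0 *m G) 0 i.

Let zero_ratio j i s : i \notin W -> ((e j + s *: e 0) *m G) 0 i = 0 <-> s = ratio j i.
Proof.
rewrite notW => i0; rewrite entryD entryZ /ratio; split=> [h|->].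
  apply: (mulIf i0); rewrite divfK //; apply: (eq_from_sub h); ring.
by rewrite divfK ?addrN.
Qed.

Let dir_sep j s i t u v : j != 0 -> i \notin W -> s = ratio j i -> t != 0 ->
  u - v = t *: (e j + s *: e 0) -> g u != g v.
Proof.
move=> j0 iW sr t0 E; apply: sep.
  by rewrite -subr_eq0 E scaler_eq0 negb_or t0 dir_neq0.
rewrite E -[X in (X <= _)%N](cardWj j0).
have -> : (#|W :\ wid j|.+1 = #|i |: (W :\ wid j)|)%N.
  by rewrite cardsU1 !inE (negbTE iW) andbF.
apply: subset_leq_card; apply/subsetP => l; rewrite in_setU1 => lin; rewrite inE entryZ.
case/orP: lin => [/eqP->|lW].
  by rewrite (zero_ratio _ _ iW).2 // mulr0.
by have := subsetP (zeros_dir j s) _ lW; rewrite inE => /eqP->; rewrite mulr0.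
Qed.

Let ratio_inj j : j != 0 -> {in ~: W &, injective (ratio j)}.
Proof.
move=> j0 i l; rewrite !in_setC => iW lW eqr; apply/eqP; apply: contraT => nil.
have := is_arcP _ arcG _ (dir_neq0 (ratio j i) j0); rewrite leqNgt => /negP[].
rewrite -[X in (X < _)%N](cardWj j0).
have -> : (#|W :\ wid j|.+2 = #|l |: (i |: (W :\ wid j))|)%N.
  by rewrite !cardsU1 !inE (negbTE iW) (negbTE lW) !andbF orbF eq_sym nil.
apply: subset_leq_card; apply/subsetP => x; rewrite !in_setU1 => /or3P[/eqP->|/eqP->|].
- by rewrite inE (zero_ratio _ _ lW).2.
- by rewrite inE (zero_ratio _ _ iW).2.
exact: (subsetP (zeros_dir _ _)).
Qed.

(** Through any u, and for any j <> 0, the level set of g contains a whole line in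
    the plane spanned by e j and e 0. *)
Lemma slope_exists j u : j != 0 ->
  exists s, forall t, g (u + t *: e j + (s * t) *: e 0) = g u.
Proof.
move=> j0; pose f t := invF (@inj0 (u + t *: e j)) (g u).
have gf t : g (u + t *: e j + f t *: e 0) = g u by apply: (f_invF (@inj0 _)).
have f0 : f 0 = 0 by apply: (@inj0 (u + 0 *: e j)); rewrite gf !scale0r !addr0.
have [] := @few_slopes_affine F f [set ratio j i | i in ~: W].
- move=> x y nxy; apply/imsetP => -[i]; rewrite in_setC => iW sr.
  have xy0 : x - y != 0 by rewrite subr_eq0.
  have := @dir_sep j _ i (x - y) (u + x *: e j + f x *: e 0)
    (u + y *: e j + f y *: e 0) j0 iW sr xy0.
  rewrite !gf eqxx => /(_ _)/negP; apply=> //.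
  rewrite scalerDr scalerA [X in _ = _ + X *: _]mulrC divfK // !scalerBl.
  by rewrite opprD addrACA; congr (_ + _); rewrite opprD addrACA subrr add0r.
- have := cardsC [set ratio j i | i in ~: W].
  rewrite card_in_imset; last exact: ratio_inj.
  have := cardsC W; rewrite cardW card_ord => cW cR.
  by move: n_large cW cR kn; move: #|_| #|_| #|_| => a b c; lia.
by move=> s fs; exists s => t; have -> : s * t = f t by rewrite fs f0 add0r.
Qed.

(* The slope of that line. *)
Let slp j u : F := odflt 0 [pick s | [forall t, g (u + t *: e j + (s * t) *: e 0) == g u]].

Let slpP j u t : j != 0 -> g (u + t *: e j + (slp j u * t) *: e 0) = g u.
Proof.
move=> j0; rewrite /slp; case: pickP => [s /forallP/(_ t)/eqP //|none].
by have [s hs] := slope_exists u j0; case/forallP: (none s) => x; rewrite hs.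
Qed.

Let slp_uniq j u s : j != 0 -> g (u + e j + s *: e 0) = g u -> slp j u = s.
Proof.
by move=> j0 gs; apply: (@inj0 (u + e j)); rewrite gs -(slpP u 1 j0) scale1r mulr1.
Qed.

Let wid0_notin : wid 0 \notin W.
Proof. by apply/imsetP => -[l + /wid_inj l0]; rewrite -l0 !inE. Qed.

(* A direction of slope 0 would vanish at the first position and on W minus one. *)
Let slp_neq0 j u : j != 0 -> slp j u != 0.
Proof.
move=> j0; apply/eqP => s0.
have r0 : 0 = ratio j (wid 0) by rewrite /ratio eE (negbTE j0) oppr0 mul0r.
have := slpP u 1 j0; rewrite s0 mul0r scale0r scale1r addr0; apply/eqP.
apply: (@dir_sep j 0 (wid 0) 1) => //; first exact: oner_neq0.
by rewrite scale0r addr0 scale1r addrAC subrr add0r.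
Qed.

Let slp_level j u y : j != 0 -> slp j (u + y *: e 0) = slp j u.
Proof.
move=> j0; apply/eqP; apply: contraT; rewrite -subr_eq0 => ns.
set s' := slp j _ in ns *; set s := slp j u in ns *.
(* The lines of slopes s and s' through u and u + y e 0 meet at this t. *)
pose t := - y / (s' - s).
have : g (u + y *: e 0) = g (u + 0 *: e 0).
  rewrite scale0r addr0 -(slpP _ t j0) -/s' -[RHS](slpP _ t j0) -/s.
  congr g; rewrite [u + y *: e 0 + _]addrAC -!addrA -scalerDl; do 2!congr (_ + _).
  by congr (_ *: _); rewrite /t; field.
move/inj0 => y0; move: ns; rewrite /s' /s y0 scale0r addr0 subrr eqxx //.
Qed.

Let slp_move j i u t : j != 0 -> slp j (u + t *: e i) = slp j u.
Proof.
move=> j0; case: (eqVneq i 0) => [->|i0]; first exact: slp_level.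
pose ut x := u + x *: e i + (slp i u * x) *: e 0.
pose v := u + 1 *: e j + (slp j u * 1) *: e 0.
have regroup (a b z : 'rV[F]_k.+1) (x1 x2 x3 x4 : F) : x1 + x2 = x3 * 1 + x4 ->
    u + a + x1 *: z + b + x2 *: z = u + 1 *: b + (x3 * 1) *: z + a + x4 *: z.
  move=> E; rewrite scale1r (addrAC _ (x1 *: z) b) -[LHS]addrA -scalerDl E.
  by rewrite (addrAC _ (_ *: z) a) -[RHS]addrA -scalerDl (addrAC u a b).
(* Inside the level set of u, move by e j then x e i, or by x e i then e j, each move
   corrected by a multiple of e 0; both ways end at the same point. *)
have affine x : slp j (ut x) = slp j u + x * (slp i v - slp i u).
  apply: slp_uniq => //.
  have -> : g (ut x) = g (v + x *: e i + (slp i v * x) *: e 0).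
    by rewrite slpP // /v slpP // /ut slpP.
  congr g; apply: regroup; ring.
(* A nonconstant affine function of x would take the value 0. *)
have const : slp i v - slp i u = 0.
  apply/eqP; apply: contraT => d0.
  have := slp_neq0 (ut (- slp j u / (slp i v - slp i u))) j0.
  by rewrite affine divfK // addrN eqxx.
rewrite -(slp_level _ (slp i u * t) j0) -/(ut t) affine const mulr0 addr0 //.
Qed.

Let slp_const j u : j != 0 -> slp j u = slp j 0.
Proof.
move=> j0; rewrite (coords u); elim: (index_enum _) => [|i r IH]; first by rewrite big_nil.
by rewrite big_cons addrC slp_move.
Qed.

(** The function g is a linear form followed by a permutation of F. *)
Theorem extension_linear :
  exists h : 'cV[F]_k.+1, exists p : {perm F}, forall u, g u = p ((u *m h) 0 0).
Proof.
pose c : 'cV[F]_k.+1 := \col_j (if j == 0 then 1 else - slp j 0).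
exists (G1 *m c), (perm (@inj0 0)) => u; rewrite permE add0r mulmxA.
set y := u *m G1.
(* g is invariant under translation by each e j + slp j 0 e 0. *)
have invar w (r : seq 'I_k.+1) :
    g (w + \sum_(j <- r | j != 0) y 0 j *: (e j + slp j 0 *: e 0)) = g w.
  elim: r w => [|j r IH] w; first by rewrite big_nil addr0.
  rewrite big_cons; case: ifP => [j0|_]; last exact: IH.
  rewrite addrA IH scalerDr addrA -[RHS](slpP w (y 0 j) j0) (slp_const w j0).
  by rewrite scalerA mulrC.
rewrite -[RHS](invar _ (index_enum _)); congr g.
have cu := coords u; rewrite -/y in cu; clearbody y.
have -> : (y *m c) 0 0 = y 0 0 - \sum_(j | j != 0) y 0 j * slp j 0.
  rewrite mxE (bigD1 0) //= [c 0 0]mxE eqxx mulr1; congr (_ + _).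
  by rewrite -sumrN; apply: eq_bigr => j j0; rewrite [c j 0]mxE (negbTE j0) mulrN.
rewrite {1}cu (bigD1 0) //= scalerBl -addrA; congr (_ + _).
rewrite scaler_suml -sumrN -big_split /=; apply: eq_bigr => j j0.
by rewrite scalerDr scalerA addrC addrK.
Qed.
End LinearExtension.

(** * Two points extending a large arc *)

(** The column Q extends the arc formed by the columns of H with index in J. *)
Definition extends_on (F : finFieldType) (k m : nat) (H : 'M[F]_(k.+1, m))
    (J : {set 'I_m}) (Q : 'cV[F]_k.+1) : Prop :=
  forall u, u != 0 -> (u *m Q) 0 0 = 0 -> (#|zero_cols H u :&: J| < k)%N.

Section TwoPoints.
Variables (F : finFieldType) (k m : nat) (H : 'M[F]_(k.+1, m)) (J : {set 'I_m}).
Hypothesis arcH : is_arc H.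

Let arc_zero u (S : {set 'I_m}) : S \subset zero_cols H u -> (k < #|S|)%N -> u = 0.
Proof.
move=> Su Sk; apply/eqP; apply: contraT => /(is_arcP _ arcH); rewrite leqNgt => /negP[].
exact: leq_trans Sk (subset_leq_card Su).
Qed.

Let ext_zero Q u (S : {set 'I_m}) : extends_on H J Q -> S \subset zero_cols H u ->
  S \subset J -> (k <= #|S|)%N -> (u *m Q) 0 0 = 0 -> u = 0.
Proof.
move=> extQ Su SJ Sk uQ; apply/eqP; apply: contraT => /extQ/(_ uQ); rewrite ltnNge => /negP[].
by apply: leq_trans Sk (subset_leq_card _); rewrite subsetI Su.
Qed.

Variables (P Q : 'cV[F]_k.+1).
Hypotheses (extP : extends_on H J P) (extQ : extends_on H J Q).
Hypothesis nonprop : forall c, Q != c *: P.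
Hypothesis J_large : (2 * #|F| + 3 * k < 3 * #|J|.+1)%N.

(** P and Q together extend the arc J: a nonzero u orthogonal to both is
    orthogonal to at most k - 2 points of J. *)
Lemma two_points (u : 'rV_k.+1) : u != 0 -> (u *m P) 0 0 = 0 -> (u *m Q) 0 0 = 0 ->
  (#|zero_cols H u :&: J|.+1 < k)%N.
Proof.
move=> u0n u0P u0Q; rewrite ltnNge; apply/negP => many.
have few := extP u0n u0P.
set u0 := u in u0n u0P u0Q many few.
have [B Bsub cB] : exists2 B : {set 'I_m}, B \subset zero_cols H u0 :&: J & #|B| = k.-1.
  by apply: subset_of_card; lia.
have [Bu0 BJ] : B \subset zero_cols H u0 /\ B \subset J by move: Bsub; rewrite subsetI => /andP.
have {cB} cB : #|B|.+1 = k by rewrite cB prednK //; lia.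
pose K := J :\: B.
have cK : (#|K| + #|B| = #|J|)%N by rewrite cardsD (setIidPr BJ) subnK // subset_leq_card.
have q_gt1 : (1 < #|F|)%N by exact: card_finNzRing_gt1.
have K_large : (2 * #|F| < 3 * #|K|)%N by lia.
have KP j : j \in K -> (j \notin B) * (j \in J) by rewrite inE => /andP[-> ->].
have [S SK cS] : exists2 S : {set 'I_m}, S \subset K & #|S| = 2.
  by apply: subset_of_card; lia.
have [A [A' [nA SE]]] : exists A A', A != A' /\ S = [set A; A'].
  by have /cards2P[x [y [nxy ->]]] := introT eqP cS; exists x, y.
have AK : A \in K by apply: (subsetP SK); rewrite SE !inE eqxx.
have AK' : A' \in K by apply: (subsetP SK); rewrite SE !inE eqxx orbT.
have zB v : B \subset zero_cols H v -> {in B, forall X, (v *m H) 0 X = 0}.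
  by move=> /subsetP Bv X /Bv; rewrite inE => /eqP.
have u0K : {in K, forall j, (u0 *m H) 0 j != 0}.
  move=> j jK; apply: contra (u0n) => /eqP u0j; apply/eqP.
  apply: (@ext_zero P u0 (j |: B)) => //.
  - by rewrite subUset Bu0 sub1set inE u0j eqxx.
  - by rewrite subUset BJ sub1set KP.
  by rewrite cardsU1 KP // add1n cB.
(* w and u0 span the annihilator of B. *)
have [w [wB wA wP]] : exists w,
  [/\ B \subset zero_cols H w, (w *m H) 0 A = 0 & (w *m P) 0 0 = 1].
  have [|w w0 wAB] := @common_zero _ _ _ H (A |: B).
    by rewrite cardsU1 KP // add1n cB.
  have wP : (w *m P) 0 0 != 0.
    apply: contra w0 => /eqP wP; apply/eqP; apply: (ext_zero extP wAB) => //.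
      by rewrite subUset BJ sub1set KP.
    by rewrite cardsU1 KP // add1n cB.
  exists (((w *m P) 0 0)^-1 *: w); move: wAB; rewrite subUset sub1set inE => /andP[/eqP wA wB].
  split; last by rewrite entryZ mulVf.
    by apply/subsetP => X XB; rewrite inE entryZ (zB w) // mulr0.
  by rewrite entryZ wA mulr0.
pose l := (w *m Q) 0 0.
have w0 : w != 0.
  apply/eqP => w0; move: wP; rewrite w0 mul0mx mxE => /eqP.
  by rewrite eq_sym oner_eq0.
have l0 : l != 0.
  apply: contra w0 => /eqP wQ; apply/eqP; apply: (@ext_zero Q w (A |: B)) => //.
  - by rewrite subUset wB sub1set inE wA eqxx.
  - by rewrite subUset BJ sub1set KP.
  by rewrite cardsU1 KP // add1n cB.
have annB z : B \subset zero_cols H z -> (z *m Q) 0 0 = (z *m P) 0 0 * l.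
  move=> Bz; pose c := (z *m H) 0 A / (u0 *m H) 0 A.
  have : z + (- (z *m P) 0 0) *: w + (- c) *: u0 = 0.
    apply: (@ext_zero P _ (A |: B)) => //.
    - apply/subsetP => X; rewrite in_setU1 inE !entryD !entryZ => /orP[/eqP->|XB].
        by rewrite wA mulr0 addr0 mulNr divfK ?u0K // addrN.
      by rewrite !zB // !mulr0 !addr0.
    - by rewrite subUset BJ sub1set KP.
    - by rewrite cardsU1 KP // add1n cB.
    by rewrite !entryD !entryZ wP u0P; ring.
  move/(congr1 (fun v => (v *m Q) 0 0)); rewrite !entryD !entryZ u0Q mul0mx [RHS]mxE => h.
  by apply: (eq_from_sub h); rewrite /l; ring.
(* Together with u0 and w, the vectors dual to the points of B span everything. *)
have exv X : exists v, X \in B -> [/\ B :\ X \subset zero_cols H v & (v *m H) 0 X = 1].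
  case: (boolP (X \in B)) => [XB|_]; last by exists 0.
  have cX := cardsD1 X B; rewrite XB in cX.
  have cS' : #|A |: (A' |: (B :\ X))| = k.
    by rewrite !cardsU1 !inE negb_or nA !negb_and !KP // !orbT -cB cX.
  have [|v v0 vS] := @common_zero _ _ _ H (A |: (A' |: (B :\ X))); first by rewrite cS'.
  move: (vS); rewrite !subUset !sub1set => /and3P[vA vA' vB].
  have vX : (v *m H) 0 X != 0.
    apply: contra v0 => vX; apply/eqP; apply: (@arc_zero _ (X |: (A |: (A' |: (B :\ X))))).
      by rewrite subUset vS sub1set inE vX.
    rewrite cardsU1 cS' !inE eqxx /= orbF negb_or.
    by rewrite (contraTneq _ XB) ?(contraTneq _ XB) // => ->; rewrite KP.
  exists (((v *m H) 0 X)^-1 *: v) => _; split; last by rewrite entryZ mulVf.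
  by apply/subsetP => Y /(subsetP vB); rewrite !inE entryZ => /eqP->; rewrite mulr0.
have [vs vsP] := fin_all_exists exv.
(* Q - l P is nonzero and kills the annihilator of B, so it detects some X in B. *)
have [X XB RX] : exists2 X, X \in B & (vs X *m Q) 0 0 != (vs X *m P) 0 0 * l.
  apply/exists_inP; apply: contraT; rewrite negb_exists_in => /forall_inP all0.
  have R0 (v : 'rV_k.+1) : (v *m Q) 0 0 = (v *m P) 0 0 * l.
    pose z := v + \sum_(X in B) (- (v *m H) 0 X) *: vs X.
    have zBz : B \subset zero_cols H z.
      apply/subsetP => Y YB; rewrite inE /z entryD entry_sum (bigD1 Y) //=.
      rewrite big1 ?addr0 => [|X /andP[XB nXY]].
        by rewrite entryZ; have [_ ->] := vsP Y YB; rewrite mulr1 addrN.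
      have [/subsetP vB _] := vsP X XB.
      have : Y \in B :\ X by rewrite !inE eq_sym nXY.
      by move/vB; rewrite inE entryZ => /eqP->; rewrite mulr0.
    have := annB z zBz; rewrite /z !entryD !entry_sum mulrDl mulr_suml => h.
    apply: (addIr (\sum_(X in B) ((- (v *m H) 0 X *: vs X) *m Q) 0 0)); rewrite h.
    congr (_ + _); apply: eq_bigr => X XB; have := all0 X XB.
    by rewrite negbK !entryZ -mulrA => /eqP->.
  case/eqP: (nonprop l); apply/matrixP => a b; rewrite !ord1 mxE.
  have rowE' (T : 'cV[F]_k.+1) : T a 0 = ((delta_mx 0 a : 'rV_k.+1) *m T) 0 0.
    by rewrite -rowE mxE.
  by rewrite (rowE' Q) (rowE' P) R0 mulrC.
have [vB vX] := vsP X XB; set v := vs X in RX vB vX.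
have BXw : B :\ X \subset zero_cols H w by rewrite (subset_trans _ wB) // subD1set.
have BXu0 : B :\ X \subset zero_cols H u0 by rewrite (subset_trans _ Bu0) // subD1set.
have BXJ : B :\ X \subset J by rewrite (subset_trans _ BJ) // subD1set.
have cX : #|B :\ X|.+2 = k by rewrite -cB (cardsD1 X B) XB.
(* Project from B minus X: the coordinates u0, u1, u2 vanish on B minus X, and
   u0 also on P, Q and X; u1 kills Q, u2 kills P and u1 + u2 kills X. *)
pose u1 := v + (- ((v *m Q) 0 0 / l)) *: w.
pose u2 := (-1) *: v + (v *m P) 0 0 *: w.
have zw j : j \in B -> (w *m H) 0 j = 0 by move/(subsetP wB); rewrite inE => /eqP.
have zu0 j : j \in B -> (u0 *m H) 0 j = 0 by move/(subsetP Bu0); rewrite inE => /eqP.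
have zv j : j \in B :\ X -> (v *m H) 0 j = 0 by move/(subsetP vB); rewrite inE => /eqP.
have u1Q : (u1 *m Q) 0 0 = 0 by rewrite entryD entryZ -/l mulNr divfK ?addrN.
have u2P : (u2 *m P) 0 0 = 0 by rewrite entryD !entryZ wP; ring.
have u1P : (u1 *m P) 0 0 != 0.
  rewrite entryD entryZ wP mulr1 subr_eq0; apply: contra RX => /eqP->.
  by rewrite divfK.
have u2Q : (u2 *m Q) 0 0 != 0.
  by rewrite entryD !entryZ -/l mulN1r addrC subr_eq0 eq_sym.
have BX z a b c : z = a *: u0 + b *: u1 + c *: u2 -> B :\ X \subset zero_cols H z.
  move=> ->; apply/subsetP => j jBX; have jB := subsetP (subD1set _ _) _ jBX.
  by rewrite inE !entryD !entryZ !entryD !entryZ zu0 // zv // zw // !(mulr0, addr0).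
pose pt j := ((u1 *m H) 0 j / (u0 *m H) 0 j, (u2 *m H) 0 j / (u0 *m H) 0 j).
have comb a b c j : j \in K -> a + b * (pt j).1 + c * (pt j).2 = 0 ->
    ((a *: u0 + b *: u1 + c *: u2) *m H) 0 j = 0.
  move=> /u0K j0 /(congr1 ( *%R^~ ((u0 *m H) 0 j))); rewrite mul0r => E.
  rewrite !entryD !entryZ -[RHS]E /pt /=; by field.
have inj1 : {in K &, injective (fun j => (pt j).1)}.
  move=> i j iK jK eqx; apply/eqP; apply: contraT => nij.
  have : (- (pt i).1) *: u0 + 1 *: u1 + 0 *: u2 = 0.
    apply: (@ext_zero Q _ (i |: (j |: (B :\ X)))) => //.
    - rewrite !subUset !sub1set !inE; apply/and3P; split.
      + by apply/eqP/comb => //; ring.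
      + by apply/eqP/comb => //; rewrite eqx; ring.
      exact: BX.
    - by rewrite !subUset !sub1set (KP _ iK) (KP _ jK).
    - by rewrite !cardsU1 !inE negb_or nij (negbTE (KP _ iK).1) (negbTE (KP _ jK).1) !andbF -cX.
    by rewrite !entryD !entryZ u0Q u1Q; ring.
  move/(congr1 (fun v => (v *m P) 0 0)); rewrite !entryD !entryZ u0P u2P mul0mx [RHS]mxE => /eqP.
  by rewrite !mulr0 mul1r add0r addr0 (negbTE u1P).
have inj2 : {in K &, injective (fun j => (pt j).2)}.
  move=> i j iK jK eqx; apply/eqP; apply: contraT => nij.
  have : (- (pt i).2) *: u0 + 0 *: u1 + 1 *: u2 = 0.
    apply: (@ext_zero P _ (i |: (j |: (B :\ X)))) => //.
    - rewrite !subUset !sub1set !inE; apply/and3P; split.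
      + by apply/eqP/comb => //; ring.
      + by apply/eqP/comb => //; rewrite eqx; ring.
      exact: BX.
    - by rewrite !subUset !sub1set (KP _ iK) (KP _ jK).
    - by rewrite !cardsU1 !inE negb_or nij (negbTE (KP _ iK).1) (negbTE (KP _ jK).1) !andbF -cX.
    by rewrite !entryD !entryZ u0P u2P; ring.
  move/(congr1 (fun v => (v *m Q) 0 0)); rewrite !entryD !entryZ u0Q u1Q mul0mx [RHS]mxE => /eqP.
  by rewrite !mulr0 mul1r !add0r (negbTE u2Q).
have injD : {in K &, injective (fun j => (pt j).1 + (pt j).2)}.
  move=> i j iK jK eqx; apply/eqP; apply: contraT => nij.
  have : (- ((pt i).1 + (pt i).2)) *: u0 + 1 *: u1 + 1 *: u2 = 0.
    apply: (@arc_zero _ (i |: (j |: (X |: (B :\ X))))).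
    - rewrite !subUset !sub1set !inE; apply/and4P; split.
      + by apply/eqP/comb => //; ring.
      + by apply/eqP/comb => //; rewrite eqx; ring.
      + by rewrite !entryD !entryZ !entryD !entryZ zu0 // zw // vX; apply/eqP; ring.
      exact: BX.
    by rewrite setD1K // !cardsU1 !inE negb_or nij (negbTE (KP _ iK).1) (negbTE (KP _ jK).1) -cB.
  move/(congr1 (fun v => (v *m P) 0 0)); rewrite !entryD !entryZ u0P u2P mul0mx [RHS]mxE => /eqP.
  by rewrite !mulr0 mul1r add0r addr0 (negbTE u1P).
apply: (@no_large_triple_arc F [set pt j | j in K]).
- by move=> _ _ /imsetP[i iK ->] /imsetP[j jK ->] /inj1->.
- by move=> _ _ /imsetP[i iK ->] /imsetP[j jK ->] /inj2->.
- by move=> _ _ /imsetP[i iK ->] /imsetP[j jK ->] /injD->.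
- move=> _ _ _ /imsetP[h hK ->] /imsetP[i iK ->] /imsetP[j jK ->] nhi nhj nij.
  apply/negP => /eqP; rewrite /det3 => det0.
  pose b := - ((pt i).2 - (pt h).2); pose c := (pt i).1 - (pt h).1.
  have c0 : c != 0.
    by rewrite subr_eq0; apply: contra (nhi) => /eqP/inj1->.
  have : (- (b * (pt h).1 + c * (pt h).2)) *: u0 + b *: u1 + c *: u2 = 0.
    apply: (@arc_zero _ (h |: (i |: (j |: (B :\ X))))).
    - rewrite !subUset !sub1set !inE; apply/and4P; split.
      + by apply/eqP/comb => //; ring.
      + by apply/eqP/comb => //; rewrite /b /c; ring.
      + by apply/eqP/comb => //; apply: (eq_from_sub det0); rewrite /b /c; ring.
      exact: BX.
    have ne x y : pt x != pt y -> x != y by apply: contraNneq => ->.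
    by rewrite !cardsU1 !inE !negb_or (ne _ _ nhi) (ne _ _ nhj) (ne _ _ nij)
      (negbTE (KP _ hK).1) (negbTE (KP _ iK).1) (negbTE (KP _ jK).1) !andbF -cX.
  move/(congr1 (fun v => (v *m Q) 0 0)); rewrite !entryD !entryZ u0Q u1Q mul0mx [RHS]mxE => /eqP.
  by rewrite !mulr0 !add0r mulf_eq0 (negbTE c0) (negbTE u2Q).
rewrite card_in_imset; last by move=> i j iK jK /(congr1 fst)/inj1->.
exact: K_large.
Qed.
End TwoPoints.

(** * Codes given by an arc and column relabellings *)

Section Codes.
Variable F : finFieldType.
Implicit Types (k m n : nat).

(** The word of the message u in the linear code of H, relabelled in each column. *)
Definition encode k m (H : 'M[F]_(k.+1, m)) (p : 'I_m -> {perm F})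
    (u : 'rV[F]_k.+1) : 'rV[F]_m :=
  \row_j p j ((u *m H) 0 j).

(** The set of all relabelled words u *m H. *)
Definition code k m (H : 'M[F]_(k.+1, m)) (p : 'I_m -> {perm F}) : {set 'rV[F]_m} :=
  [set encode H p u | u : 'rV[F]_k.+1].

(** The relabelling that leaves all columns unchanged. *)
Definition no_relabel m : 'I_m -> {perm F} := fun=> 1%g.

Lemma encode1 k m (H : 'M[F]_(k.+1, m)) u : encode H (@no_relabel m) u = u *m H.
Proof. by apply/rowP => j; rewrite mxE perm1. Qed.

Lemma code1 k m (H : 'M[F]_(k.+1, m)) :
  code H (@no_relabel m) = [set u *m H | u : 'rV[F]_k.+1].
Proof. by apply: eq_imset => u; rewrite encode1. Qed.

Lemma agree_encode k m (H : 'M[F]_(k.+1, m)) p u v :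
  [set i | encode H p u ord0 i == encode H p v ord0 i] = zero_cols H (u - v).
Proof.
apply/setP => i; rewrite !inE ![encode _ _ _ _ _]mxE (inj_eq perm_inj).
by rewrite mulmxBl -subr_eq0 !mxE.
Qed.

Lemma encode_inj k m (H : 'M[F]_(k.+1, m)) p :
  is_arc H -> (k < m)%N -> injective (encode H p).
Proof.
move=> arcH km u v euv; apply/eqP; rewrite -subr_eq0; apply: contraT => nz.
have := is_arcP _ arcH _ nz; rewrite -(agree_encode H p) euv.
have -> : [set i | encode H p v ord0 i == encode H p v ord0 i] = setT.
  by apply/setP => i; rewrite !inE eqxx.
by rewrite cardsT card_ord leqNgt km.
Qed.

Lemma code_mds k m (H : 'M[F]_(k.+1, m)) p :
  is_arc H -> (k < m)%N -> is_mds k.+1 (code H p).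
Proof.
move=> arcH km; split.
  by rewrite /code card_imset ?cardsT ?card_mx ?mul1n //; apply: encode_inj.
move=> _ _ /imsetP[u _ ->] /imsetP[v _ ->] nuv; rewrite agree_encode ltnS.
by apply: (is_arcP _ arcH); rewrite subr_eq0; apply: contra nuv => /eqP->.
Qed.

Lemma mds_arc k m (H : 'M[F]_(k.+1, m)) p : is_mds k.+1 (code H p) -> is_arc H.
Proof.
case=> cardC sepC; have inj : injective (encode H p).
  have /eqP/imset_injP inj : #|code H p| = #|{: 'rV[F]_k.+1}|.
    by rewrite cardC card_mx mul1n.
  by move=> u v; apply: inj; rewrite inE.
apply/is_arcP => u u0; rewrite -[u]subr0 -(agree_encode H p) -ltnS.
by apply: sepC; rewrite ?imset_f ?inE // (inj_eq inj).
Qed.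

Lemma linear_code k m (H : 'M[F]_(k.+1, m)) : is_arc H -> (k < m)%N ->
  is_linear k.+1 (code H (@no_relabel m)).
Proof.
move=> arcH km; pose f : 'Hom('rV[F]_k.+1, 'rV[F]_m) := linfun (mulmxr H).
exists (limg f); split.
  rewrite limg_dim_eq ?dimvf /dim /= ?mul1n //.
  apply/eqP; rewrite capfv; apply/lker0P => u v; rewrite !lfunE /=.
  by rewrite -!encode1; apply: encode_inj.
rewrite code1; apply/setP => w; rewrite inE; apply/imsetP/memv_imgP => -[u _ ->]; exists u => //.
  by rewrite memvf. by rewrite lfunE. by rewrite lfunE.
Qed.

Lemma linear_generator d n (C : {set 'rV[F]_n}) : is_linear d C ->
  exists G : 'M[F]_(d, n), C = [set u *m G | u : 'rV[F]_d].
Proof.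
case=> U [dU ->]; case: d / dU; exists (\matrix_i (vbasis U)`_i).
have uG u : u *m \matrix_i (vbasis U)`_i = \sum_i u 0 i *: (vbasis U)`_i.
  by rewrite mulmx_sum_row; apply: eq_bigr => i _; rewrite rowK.
apply/setP => w; rewrite inE; apply/idP/imsetP => [wU|[u _ ->]].
  exists (\row_i coord (vbasis U) i w) => //; rewrite uG {1}(coord_vbasis wU).
  by apply: eq_bigr => i _; rewrite mxE.
rewrite uG; apply: memv_suml => i _; apply: memvZ; apply: vbasis_mem.
by rewrite mem_nth // size_tuple.
Qed.

(** Applying a permutation of the alphabet to every column at once. *)
Definition relabel n (p : 'I_n -> {perm F}) (w : 'rV[F]_n) : 'rV[F]_n := \row_j p j (w 0 j).

Lemma equiv_relabel n (p : 'I_n -> {perm F}) (C : {set 'rV[F]_n}) :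
  code_equiv C [set relabel p w | w in C].
Proof.
pose part (r : seq 'I_n) (w : 'rV[F]_n) : 'rV[F]_n :=
  \row_j (if j \in r then p j (w 0 j) else w 0 j).
have step r : uniq r -> code_equiv C [set part r w | w in C].
  elim: r => [_|j r IH /= /andP[jr /IH eqv]].
    rewrite (_ : [set _ | _ in C] = C); first exact: Equiv_refl.
    rewrite -[RHS]imset_id; apply: eq_imset => w; apply/rowP => j.
    by rewrite mxE.
  have := Equiv_symbols j (p j) eqv; congr code_equiv.
  rewrite -imset_comp; apply: eq_imset => w; apply/rowP => i; rewrite !mxE /= inE.
  by case: eqVneq => [->|] //; rewrite (negbTE jr).
have := step (enum 'I_n) (enum_uniq _); congr code_equiv.
by apply: eq_imset => w; apply/rowP => j; rewrite !mxE mem_enum.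
Qed.

Lemma relabel_encode k m (H : 'M[F]_(k.+1, m)) p q u :
  relabel q (encode H p u) = encode H (fun j => p j * q j)%g u.
Proof. by apply/rowP => j; rewrite !mxE permM. Qed.

Lemma relabel_code k m (H : 'M[F]_(k.+1, m)) p q :
  [set relabel q w | w in code H p] = code H (fun j => p j * q j)%g.
Proof. by rewrite -imset_comp; apply: eq_imset => u; rewrite /= relabel_encode. Qed.

Lemma code_LE k m (H : 'M[F]_(k.+1, m)) p :
  is_arc H -> (k < m)%N -> is_LE k.+1 (code H p).
Proof.
move=> arcH km; exists (code H (@no_relabel m)); split; first exact: linear_code.
have := equiv_relabel (fun j => (p j)^-1)%g (code H p); congr code_equiv.
rewrite relabel_code; apply: eq_imset => u; apply/rowP => j; rewrite !mxE.
by rewrite mulgV.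
Qed.

Lemma entry_col k m (H : 'M[F]_(k, m)) (u : 'rV_k) j : (u *m col j H) 0 0 = (u *m H) 0 j.
Proof. by rewrite colE mulmxA -colE mxE. Qed.

(** The column Q extends the arc formed by all the columns of H. *)
Definition extends k m (H : 'M[F]_(k.+1, m)) (Q : 'cV[F]_k.+1) : Prop :=
  forall u, u != 0 -> (u *m Q) 0 0 = 0 -> (#|zero_cols H u| < k)%N.

Lemma card_zero_cols k m (H : 'M[F]_(k, m)) u :
  #|zero_cols H u| = (\sum_j ((u *m H) 0%R j == 0%R))%N.
Proof.
by rewrite -sum1dep_card big_mkcond; apply: eq_bigr => j _; case: eqP.
Qed.

Lemma card_zero_cols_row_mx k m1 m2 (H1 : 'M[F]_(k, m1)) (H2 : 'M[F]_(k, m2)) u :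
  #|zero_cols (row_mx H1 H2) u| = (#|zero_cols H1 u| + #|zero_cols H2 u|)%N.
Proof.
rewrite !card_zero_cols big_split_ord /= mul_mx_row; congr (_ + _)%N;
  by apply: eq_bigr => j _; rewrite ?row_mxEl ?row_mxEr.
Qed.

Lemma card_zero_cols1 k (Q : 'M[F]_(k, 1)) u : #|zero_cols Q u| = ((u *m Q) 0 0 == 0).
Proof. by rewrite card_zero_cols big_ord1. Qed.

Lemma extends_arc k m (H : 'M[F]_(k.+1, m)) Q u : is_arc H -> extends H Q -> u != 0 ->
  (((u *m Q) 0%R 0%R == 0%R) + #|zero_cols H u| <= k)%N.
Proof.
move=> arcH ext u0; case: eqP => [uQ|_]; first exact: ext.
exact: (is_arcP _ arcH).
Qed.

Lemma zero_cols_colsub k m n (f : 'I_n -> 'I_m) (H : 'M[F]_(k, m)) u :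
  f @: zero_cols (colsub f H) u = zero_cols H u :&: f @: setT.
Proof.
apply/setP => j; rewrite inE; apply/imsetP/andP => [[i + ->]|[+ /imsetP[i _ ej]]].
  by rewrite !inE mulmx_colsub mxE => ->; rewrite imset_f.
by rewrite ej => zi; exists i => //; rewrite inE mulmx_colsub mxE; move: zi; rewrite inE.
Qed.

Lemma extends_col k m n (f : 'I_n -> 'I_m) (H : 'M[F]_(k.+1, m)) j :
  is_arc H -> injective f -> j \notin codom f -> extends (colsub f H) (col j H).
Proof.
move=> arcH injf jf u u0 uj; rewrite -(card_imset _ injf).
apply: leq_trans (is_arcP _ arcH u u0); rewrite zero_cols_colsub.
have <- : #|j |: (zero_cols H u :&: f @: setT)| = #|zero_cols H u :&: f @: setT|.+1.
  rewrite cardsU1 !inE; suff -> : (j \in f @: setT) = false by rewrite andbF.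
  by apply: contraNF jf => /imsetP[i _ ->]; rewrite codom_f.
apply: subset_leq_card; rewrite subUset subsetIl andbT sub1set inE.
by move: uj; rewrite entry_col => ->.
Qed.

Lemma codom_colsub k m n (f : 'I_n -> 'I_m) (H : 'M[F]_(k, m)) i :
  col (f i) H = col i (colsub f H).
Proof. by apply/colP => a; rewrite !mxE. Qed.

(** Every extension of the linear code of G is, up to relabelling, the linear code
    of an arc containing the columns of G. *)
Lemma extension_code k m n (G : 'M[F]_(k.+1, n)) (D : {set 'rV[F]_m}) :
  is_arc G -> (k.+1 <= n)%N -> ((#|F| + k - n.+1) ^ 2 < #|F|)%N ->
  is_extension k.+1 (code G (@no_relabel n)) D ->
  exists (H : 'M[F]_(k.+1, m)) (p : 'I_m -> {perm F}) (f : 'I_n -> 'I_m),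
    [/\ D = code H p, is_arc H, injective f & colsub f H = G].
Proof.
move=> arcG kn large [nm [cardC _] [cardD sepD] [f [fmono CE]]].
have injf : injective f.
  move=> i j eqf; apply/val_inj; apply/eqP; apply: contraT; rewrite neq_ltn => /orP[] /fmono;
    by rewrite eqf ltnn.
have injD : {in D &, injective (colsub f : 'rV[F]_m -> 'rV[F]_n)}.
  by apply/imset_injP; rewrite -CE cardC cardD.
have exd (u : 'rV[F]_k.+1) : exists w, w \in D /\ colsub f w = u *m G.
  have : u *m G \in code G (@no_relabel n) by rewrite code1; apply/imsetP; exists u.
  by rewrite CE => /imsetP[w wD ->]; exists w.
have [d dP] := fin_all_exists exd.
have dD u := (dP u).1; have dG u := (dP u).2.
have DE : D = [set d u | u : 'rV[F]_k.+1].
  apply/setP => w; apply/idP/imsetP => [wD|[u _ ->] //].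
  have : colsub f w \in code G (@no_relabel n) by rewrite CE; apply/imsetP; exists w.
  by rewrite code1 => /imsetP[u _ wG]; exists u => //; apply: injD; rewrite // dG.
have injd : injective d.
  move=> u v duv; apply: (@encode_inj k n G (@no_relabel n) arcG kn).
  by rewrite !encode1 -!dG duv.
have df u i : d u 0 (f i) = (u *m G) 0 i by rewrite -dG mxE.
(* Kept positions carry the columns of G; the others are linear by extension_linear. *)
have exh j : exists hp : 'cV[F]_k.+1 * {perm F},
    (forall u, d u 0 j = hp.2 ((u *m hp.1) 0 0)) /\ (forall i, f i = j -> hp.1 = col i G).
  case: (boolP (j \in codom f)) => [/codomP[i ->]|jf].
    exists (col i G, 1%g); split=> [u|l /injf-> //] /=.
    by rewrite perm1 df entry_col.
  have [|h [p hp]] := @extension_linear F k n G arcG kn large (fun u => d u 0 j).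
    move=> u v nuv many; apply/negP => /eqP duv.
    have := sepD _ _ (dD u) (dD v); rewrite (inj_eq injd) nuv => /(_ isT).
    rewrite ltnNge => /negP[]; apply: leq_ltn_trans many _.
    rewrite -(card_imset _ injf).
    have jn : j \notin f @: zero_cols G (u - v).
      by apply: contra jf => /imsetP[i _ ->]; rewrite codom_f.
    have -> : (#|f @: zero_cols G (u - v)| < #|[set i | d u ord0 i == d v ord0 i]|)%N =
       (#|j |: f @: zero_cols G (u - v)| <= #|[set i | d u ord0 i == d v ord0 i]|)%N.
      by rewrite cardsU1 jn.
    apply: subset_leq_card; rewrite subUset sub1set inE duv eqxx /=.
    apply/subsetP => _ /imsetP[i + ->]; rewrite !inE !df mulmxBl.
    by rewrite mxE [X in _ + X]mxE subr_eq0.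
  exists (h, p); split=> [u|i fi]; first exact: hp.
  by case/negP: jf; rewrite -fi codom_f.
have [hp hpP] := fin_all_exists exh.
pose H : 'M[F]_(k.+1, m) := \matrix_(a, j) (hp j).1 a 0.
have uH u j : (u *m H) 0 j = (u *m (hp j).1) 0 0.
  by rewrite !mxE; apply: eq_bigr => a _; rewrite mxE.
have DH : D = code H (fun j => (hp j).2).
  rewrite DE; apply: eq_imset => u; apply/rowP => j.
  by rewrite mxE uH (proj1 (hpP j)).
exists H, (fun j => (hp j).2), f; split=> //.
  by apply: (@mds_arc k m H (fun j => (hp j).2)); rewrite -DH.
by apply/matrixP => a i; rewrite !mxE (proj2 (hpP (f i)) i) // mxE.
Qed.

(** A code whose arc is extended by a vector has an extension. *)
Lemma code_extension k m (H : 'M[F]_(k.+1, m)) p (Q : 'cV[F]_k.+1) :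
  is_arc H -> (k < m)%N -> extends H Q ->
  exists C : {set 'rV[F]_(m + 1)}, is_extension k.+1 (code H p) C.
Proof.
move=> arcH km ext; pose p' (i : 'I_(m + 1)) := if split i is inl j then p j else 1%g.
have arcHQ : is_arc (row_mx H Q).
  apply/is_arcP => u u0; rewrite card_zero_cols_row_mx card_zero_cols1 addnC.
  exact: extends_arc.
exists (code (row_mx H Q) p'); split.
- by rewrite addn1.
- exact: code_mds.
- by apply: code_mds => //; rewrite addn1 ltnW.
exists (lshift 1); split=> //.
rewrite -imset_comp; apply: eq_imset => u; apply/rowP => j.
by rewrite [LHS]mxE [RHS]mxE [RHS]mxE mul_mx_row row_mxEl /p' (unsplitK (inl j)).
Qed.

(** Distinct columns of an arc are not proportional, not even with factor 0. *)
Lemma col_nonprop k m (H : 'M[F]_(k.+1, m)) (i j : 'I_m) c :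
  is_arc H -> (0 < k)%N -> (k < m)%N -> col i H = c *: col j H -> i = j.
Proof.
move=> arcH k0 km eqc; apply/eqP; apply: contraT => nij.
have [S SJ cS] : exists2 S : {set 'I_m}, S \subset ~: [set i; j] & #|S| = k.-1.
  apply: subset_of_card.
  have -> : #|~: [set i; j]| = (m - 2)%N.
    by rewrite -[m in RHS]card_ord -(cardsC [set i; j]) cards2 nij addKn.
  by lia.
have iS : i \notin S by apply/negP => /(subsetP SJ); rewrite !inE eqxx.
have jS : j \notin S by apply/negP => /(subsetP SJ); rewrite !inE eqxx orbT.
have cjS : #|j |: S| = k by rewrite cardsU1 jS cS add1n prednK.
have [|u u0 uS] := @common_zero _ _ _ H (j |: S); first by rewrite cjS.
have := is_arcP _ arcH u u0; rewrite leqNgt => /negP[].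
have ciS : #|i |: (j |: S)| = k.+1.
  by rewrite cardsU1 cjS !inE negb_or nij iS.
rewrite -[X in (X <= _)%N]ciS; apply: subset_leq_card.
rewrite subUset uS andbT sub1set inE -entry_col eqc.
move: uS; rewrite subUset sub1set inE -entry_col => /andP[/eqP uj _].
by rewrite -scalemxAr mxE uj mulr0.
Qed.

(** A vector extending a large sub-arc of H extends H, unless it is proportional to a
    column of H: add the columns of H to the sub-arc one at a time. *)
Lemma extends_all k m n (f : 'I_n -> 'I_m) (H : 'M[F]_(k.+1, m)) Q :
  is_arc H -> injective f -> (2 * #|F| + 3 * k < 3 * n.+1)%N ->
  (forall j c, Q != c *: col j H) -> extends (colsub f H) Q -> extends H Q.
Proof.
move=> arcH injf large nonprop ext.
have on (r : seq 'I_m) : extends_on H (f @: setT :|: [set x in r]) Q.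
  elim: r => [|j r IH] u u0 uQ.
    rewrite (_ : [set x in [::]] = set0) ?setU0; last by apply/setP.
    by rewrite -zero_cols_colsub card_imset //; apply: ext.
  set J := _ :|: _ in IH.
  have JE : f @: setT :|: [set x in j :: r] = j |: J by rewrite set_cons setUCA.
  rewrite JE; case: (boolP (j \in J)) => [jJ|nJ].
    by rewrite (setUidPr _) ?sub1set //; apply: IH.
  have extj : extends_on H J (col j H).
    move=> v v0 vj; apply: leq_trans (is_arcP _ arcH v v0).
    have <- : #|j |: (zero_cols H v :&: J)| = #|zero_cols H v :&: J|.+1.
      by rewrite cardsU1 inE (negbTE nJ) andbF.
    by apply: subset_leq_card; rewrite subUset subsetIl andbT sub1set inE -entry_col vj.
  have cJ : (n <= #|J|)%N.
    rewrite -[n]card_ord -cardsT -(card_imset _ injf); apply: subset_leq_card.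
    exact: subsetUl.
  case: (eqVneq ((u *m H) 0 j) 0) => [uj|nuj].
    apply: leq_ltn_trans (two_points arcH extj IH _ _ u0 _ uQ); last by rewrite entry_col.
    - rewrite setIUr (leq_trans (leq_card_setU _ _)) // -[X in (_ <= X)%N]add1n leq_add2r.
      by rewrite -[X in (_ <= X)%N](cards1 j) subset_leq_card ?subsetIr.
    - exact: nonprop.
    - by apply: leq_trans large _; rewrite leq_mul2l /= ltnS.
  apply: leq_ltn_trans (IH _ u0 uQ); apply: subset_leq_card.
  apply/subsetP => l; rewrite !in_setI in_setU1 => /andP[ul /orP[/eqP lj|->]].
    by move: ul; rewrite lj inE (negbTE nuj).
  by rewrite ul.
move=> u u0 uQ; have := on (enum 'I_m) u u0 uQ.
rewrite (_ : _ :|: _ = setT) ?setIT //.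
by apply/setP => j; rewrite !inE mem_enum orbT.
Qed.
End Codes.

(** * Complete arcs and maximal codes *)

(** Every column of an arc H is proportional to one of a complete arc H' that shares
    with H a large sub-arc. *)
Lemma proportional_cover (F : finFieldType) (k n m m' : nat)
    (f : 'I_n -> 'I_m) (f' : 'I_n -> 'I_m')
    (H : 'M[F]_(k.+1, m)) (H' : 'M[F]_(k.+1, m')) :
  is_arc H -> is_arc H' -> injective f -> injective f' -> colsub f H = colsub f' H' ->
  (2 * #|F| + 3 * k < 3 * n.+1)%N -> (forall Q, ~ extends H' Q) ->
  forall j, exists jc : 'I_m' * F, col j H = jc.2 *: col jc.1 H'.
Proof.
move=> arcH arcH' injf injf' eqG large noext j.
case: (boolP [exists jc : 'I_m' * F, col j H == jc.2 *: col jc.1 H']) => [/existsP[jc /eqP E]|].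
  by exists jc.
rewrite negb_exists => /forallP none; case: (noext (col j H)).
apply: (extends_all (f := f')) => // [l c|]; first exact: (none (l, c)).
rewrite -eqG; apply: extends_col => //.
apply/negP => /codomP[i ji]; have /negP[] := none (f' i, 1) => /=.
by rewrite scale1r ji !codom_colsub eqG.
Qed.

Lemma proportional_inj (F : finFieldType) (k m m' : nat)
    (H : 'M[F]_(k.+1, m)) (H' : 'M[F]_(k.+1, m'))
    (s : 'I_m -> 'I_m' * F) :
  is_arc H -> (0 < k)%N -> (k < m)%N -> (forall j, col j H = (s j).2 *: col (s j).1 H') ->
  (forall j, (s j).2 != 0) /\ injective (fun j => (s j).1).
Proof.
move=> arcH k0 km Hs.
have nz j : (s j).2 != 0.
  apply/eqP => s0; have [l nl] : exists l, l != j.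
    have /card_gt0P[l] : (0 < #|[set~ j]|)%N by rewrite cardsC1 card_ord; lia.
    by rewrite !inE => nl; exists l.
  case/eqP: nl; apply/esym/(@col_nonprop _ _ _ H j l 0) => //.
  by rewrite Hs s0 !scale0r.
split=> // i j eqs; apply: (@col_nonprop _ _ _ H i j ((s i).2 / (s j).2)) => //.
by rewrite !Hs scalerA divfK // eqs.
Qed.

Lemma proportional_equiv (F : finFieldType) (k m : nat) (H H' : 'M[F]_(k.+1, m))
    (p : 'I_m -> {perm F}) (s : 'I_m -> 'I_m) (c : 'I_m -> F) :
  injective s -> (forall j, c j != 0) -> (forall j, col j H = c j *: col (s j) H') ->
  code_equiv (code H' p) (code H (@no_relabel F m)).
Proof.
move=> injs c0 Hs; pose sp := perm injs.
have := Equiv_cols sp (equiv_relabel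
  (fun i => (p i)^-1 * perm (mulfI (c0 ((sp^-1) i))))%g (code H' p)).
congr code_equiv; rewrite relabel_code -imset_comp; apply: eq_imset => u.
apply/rowP => j; rewrite encode1 /= [LHS]mxE [LHS]mxE !permM permK [LHS]permE permK /sp permE.
by rewrite -(entry_col H') -(entry_col H) Hs -scalemxAr [RHS]mxE.
Qed.

(** The bound on n used for completion follows from the one used for linearity, as
    q > 8 and e ^ 2 < q imply 3 e < q. *)
Lemma length_bound (q n k : nat) : (8 < q)%N -> ((q + k - n.+1) ^ 2 < q)%N ->
  (k.+1 <= n)%N /\ (2 * q + 3 * k < 3 * n.+1)%N.
Proof.
rewrite -mulnn; move=> q9; case: (leqP (q + k) n.+1) => [le _|lt]; first by lia.
by move: (q + k - n.+1)%N (subnK (ltnW lt)) => e ee e2; nia.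
Qed.

Lemma sqrt_bound (R : rcfType) (q n k : nat) : (0 < q)%N ->
  (n%:R : R) > q%:R - Num.sqrt q%:R + k%:R - 1 -> ((q + k - n.+1) ^ 2 < q)%N.
Proof.
move=> q0 large; case: (leqP (q + k) n.+1) => [le|lt].
  by have -> : (q + k - n.+1 = 0)%N by lia.
rewrite -(ltr_nat R) natrX natrB; last exact: ltnW.
have lt' : (n.+1%:R : R) < (q + k)%:R by rewrite ltr_nat.
set x : R := (q + k)%:R - n.+1%:R.
have x0 : 0 <= x by rewrite subr_ge0 ltW.
have xs : x < Num.sqrt q%:R.
  rewrite /x natrD -addn1 natrD; lra.
have sq : Num.sqrt (q%:R : R) ^+ 2 = q%:R by rewrite sqr_sqrtr // ler0n.
by rewrite -sq ltr_pXn2r // nnegrE // sqrtr_ge0.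
Qed.

Lemma odd_nonprime_gt8 q : (1 < q)%N -> odd q -> ~~ prime q -> (8 < q)%N.
Proof. by do 9!case: q => [|q] //. Qed.

Lemma family_code (F : finFieldType) (k n m : nat) (G : 'M[F]_(k.+1, n))
    (C : {set 'rV[F]_n})
    (D : {set 'rV[F]_m}) :
  is_arc G -> (k.+1 <= n)%N -> ((#|F| + k - n.+1) ^ 2 < #|F|)%N ->
  C = code G (@no_relabel F n) -> extension_family k.+1 C D ->
  exists (H : 'M[F]_(k.+1, m)) (p : 'I_m -> {perm F}) (f : 'I_n -> 'I_m),
    [/\ D = code H p, is_arc H, injective f & colsub f H = G].
Proof.
move=> arcG kn large CG fam; case: m D / fam => [|m D ext]; last first.
  by apply: extension_code => //; rewrite -CG.
exists G, (@no_relabel F n), id; split=> //.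
by apply/matrixP => a j; rewrite mxE.
Qed.

(** Columns are added in front, so that the columns of G stay last. *)
Lemma exists_complete_arc (F : finFieldType) (k n : nat) (G : 'M[F]_(k.+1, n)) :
  is_arc G -> (0 < k)%N -> (k < n)%N ->
  exists r (A : 'M[F]_(k.+1, r)),
    is_arc (row_mx A G) /\ forall Q, ~ extends (row_mx A G) Q.
Proof.
move=> arcG k0 kn.
pose P r := [exists A : 'M[F]_(k.+1, r), is_arc (row_mx A G)].
have P0 : exists r, P r.
  exists 0%N; apply/existsP; exists (0 : 'M_(_, 0)); apply/is_arcP => u u0.
  rewrite card_zero_cols_row_mx card_zero_cols big_ord0.
  exact: (is_arcP _ arcG).
have bound r : P r -> (r <= #|{: 'cV[F]_k.+1}|)%N.
  case/existsP => A arcA; apply: leq_trans (leq_addr n r) _.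
  rewrite -[(r + n)%N]card_ord; apply: (leq_card (fun j => col j (row_mx A G))).
  move=> i j eqc; apply: (@col_nonprop _ _ _ (row_mx A G) i j 1) => //.
    by rewrite ltn_addl.
  by rewrite scale1r.
case: (ex_maxnP P0 bound) => r /existsP[A arcA] maxr.
exists r, A; split=> // Q ext.
suff /maxr : P r.+1 by rewrite ltnn.
apply/existsP; exists (row_mx Q A : 'M_(k.+1, 1 + r)); apply/is_arcP => u u0.
rewrite card_zero_cols_row_mx (card_zero_cols_row_mx Q A) card_zero_cols1 -addnA -card_zero_cols_row_mx.
exact: extends_arc.
Qed.

Lemma complete_code_maximal (F : finFieldType) (k n : nat) (H : 'M[F]_(k.+1, n)) :
  is_arc H -> (k.+1 <= n)%N -> ((#|F| + k - n.+1) ^ 2 < #|F|)%N ->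
  (forall Q, ~ extends H Q) -> is_maximal k.+1 (code H (@no_relabel F n)).
Proof.
move=> arcH kn large noext; split=> [|m D ext]; first exact: code_mds.
have [nm _ _ _] := ext.
have [H' [p [f [_ arcH' injf HE]]]] := extension_code arcH kn large ext.
have [j jf] : exists j, j \notin codom f.
  apply/existsP; apply: contraT; rewrite negb_exists => /forallP all.
  have : (#|'I_m| <= #|codom f|)%N.
    by apply/subset_leq_card/subsetP => j _; have := all j; rewrite negbK.
  by rewrite card_codom // !card_ord leqNgt nm.
by apply: (noext (col j H')); rewrite -HE; apply: extends_col.
Qed.

(** Conversely, the arc of a maximal code is complete. *)
Lemma maximal_code_complete (F : finFieldType) (k m : nat) (H : 'M[F]_(k.+1, m)) p :
  is_arc H -> (k < m)%N -> is_maximal k.+1 (code H p) -> forall Q, ~ extends H Q.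
Proof.
by move=> arcH km [_ max] Q /(code_extension p arcH km)[D /max].
Qed.

(** * Extensions of long linear codes *)

Theorem theorem7p13 (R : rcfType) (F : finFieldType) (q n k : nat)
    (C : {set 'rV[F]_n})
    (card_F : #|F| = q) (q_odd : odd q) (q_not_prime : ~~ prime q)
    (C_mds : is_mds k.+1 C) (C_lin : is_linear k.+1 C)
    (n_large : (n%:R : R) > q%:R - Num.sqrt q%:R + k%:R - 1) :
  (forall (m : nat) (D : {set 'rV[F]_m}),
     extension_family k.+1 C D -> is_LE k.+1 D) /\
  ((0 < k)%N ->
   exists (m : nat) (M : {set 'rV[F]_m}),
     [/\ extension_family k.+1 C M, is_maximal k.+1 M &
         forall (m' : nat) (M' : {set 'rV[F]_m'}),
           extension_family k.+1 C M' -> is_maximal k.+1 M' ->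
           exists e : m' = m,
             code_equiv (ecast i {set 'rV[F]_i} e M') M]).
Proof.
have q1 : (1 < q)%N by rewrite -card_F; apply: card_finNzRing_gt1.
have q9 := odd_nonprime_gt8 q1 q_odd q_not_prime.
have small := sqrt_bound (ltnW q1) n_large.
have [kn large] := length_bound q9 small.
have mono m : (n <= m)%N -> ((q + k - m.+1) ^ 2 < q)%N.
  by move=> nm; apply: leq_ltn_trans small; rewrite leq_exp2r // leq_sub2l // ltnS.
rewrite -card_F in large mono small.
have [G CG] := linear_generator C_lin.
rewrite -code1 in CG.
have arcG : is_arc G by apply: (@mds_arc _ _ _ G (@no_relabel F n)); rewrite -CG.
have len m (f : 'I_n -> 'I_m) : injective f -> (n <= m)%N.
  by move=> injf; have := leq_card f injf; rewrite !card_ord.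
split=> [m D fam|k0].
  have [H [p [f [-> arcH injf _]]]] := family_code arcG kn small CG fam.
  by apply: code_LE => //; apply: leq_trans kn (len _ _ injf).
have [r [A [arcA noext]]] := exists_complete_arc arcG k0 kn.
have injr : injective (@rshift r n) by apply: rshift_inj.
have nr := len _ _ injr.
exists (r + n)%N, (code (row_mx A G) (@no_relabel F (r + n))); split.
(* If no column is added, then M is C itself. *)
- case: r A arcA {noext injr nr} => [|r] A arcA.
    by rewrite (row_thin_mx A G) -CG; apply: Family_self.
  apply: Family_ext; split=> //.
  + by rewrite addSn ltnS leq_addl.
  + by apply: code_mds => //; rewrite ltn_addl.
  exists (@rshift r.+1 n); split=> [i j ij|]; first by rewrite ltn_add2l.
  rewrite CG -imset_comp; apply: eq_imset => u; apply/rowP => j.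
  by rewrite /= !encode1 [RHS]mxE mul_mx_row row_mxEr.
- by apply: complete_code_maximal => //; [apply: leq_trans kn nr | apply: mono].
move=> m' M' fam maxM'.
have [H' [p' [f' [ME arcH' injf' HG]]]] := family_code arcG kn small CG fam.
rewrite ME in maxM'.
have km' := leq_trans kn (len _ _ injf'); have km := leq_trans kn nr.
have noext' := maximal_code_complete arcH' km' maxM'.
have eqG : colsub (@rshift r n) (row_mx A G) = colsub f' H'.
  by rewrite HG; apply/matrixP => a j; rewrite mxE row_mxEr.
have [s sE] := fin_all_exists (proportional_cover arcA arcH' injr injf' eqG large noext').
have [s' sE'] := fin_all_exists (proportional_cover arcH' arcA injf' injr (esym eqG) large noext).
have [s0 injs] := proportional_inj arcA k0 km sE.
have [_ injs'] := proportional_inj arcH' k0 km' sE'.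
have e : m' = (r + n)%N.
  apply/eqP; rewrite eqn_leq; have := leq_card _ injs; have := leq_card _ injs'.
  by rewrite !card_ord => -> ->.
exists e; subst m'; rewrite ME /=.
exact: proportional_equiv injs s0 sE.
Qed.
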